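(* Let $E$ be a finite set of integers. If $\Phi \subseteq 2^E$ is a shifted interval, then $\Phi$ satisfies the spectral recursion.
   Context: $E$ is a finite set and $2^E$ its Boolean algebra of subsets. A set $\Phi \subseteq 2^E$ is an interval if $F \subseteq G \subseteq H$ and $F,H \in \Phi$ imply $G \in \Phi$. Elements of the ground set $E$ are the vertices of $\Phi$ (a vertex need not lie in any face); members of $\Phi$ are its faces; $\dim F = |F|-1$. $\Phi_i$ is the set of $i$-dimensional faces, $i \ge -1$. A simplicial complex is a (possibly empty) set $\Delta \subseteq 2^E$ such that $G \subseteq H \in \Delta$ implies $G \in \Delta$. If $\Delta' \subseteq \Delta$ are simplicial complexes on $E$, the relative simplicial pair $(\Delta,\Delta')$ is the set difference $\Delta \setminus \Delta'$ (it is always an interval). For $k$-subsets $F=\{f_1<\cdots<f_k\}$ and $G=\{g_1<\cdots<g_k\}$ of $E$, write $F \leq_C G$ if $f_p \leq g_p$ for all $p$. A simplicial complex $\Delta \subseteq 2^E$ is shifted if $G \leq_C H$ and $H \in \Delta$ imply $G \in \Delta$ (for $G,H\subseteq E$). An interval $\Phi$ is shifted if $\Phi = (\Delta,\Delta')$ for some shifted simplicial complexes $\Delta' \subseteq \Delta$ in $2^E$. For $e \in E$: the deletion is $\Phi - e = \{F \in \Phi : e \notin F\}$, the contraction is $\Phi/e = \{F \setminus \{e\} : F \in \Phi,\ e \in F\}$, the star is $\mathrm{st}_\Phi e = \bigcup \{F, F \cup \{e\}\}$ over all $F$ with $e \notin F$ and $F, F\cup\{e\} \in \Phi$, and the reduction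 is $\Phi \| e = \Phi \setminus \mathrm{st}_\Phi e$. Each of $\Phi-e$, $\Phi/e$, $\Phi\|e$ is again an interval in $2^E$. $C_i(\Phi;\mathbb{R})$ is the real vector space with basis $\Phi_i$; the boundary operator $\partial_i : C_i \to C_{i-1}$ sends $F = \{v_0 < \cdots < v_i\}$ to $\sum_j (-1)^j (F \setminus \{v_j\})$, the sum over those $j$ with $F\setminus\{v_j\} \in \Phi$. Let $\partial_i^*$ be its adjoint (transpose in these bases). The Laplacian is $L_i(\Phi) = \partial_{i+1}\partial_{i+1}^* + \partial_i^*\partial_i$ on $C_i(\Phi;\mathbb{R})$; its eigenvalues are non-negative reals and do not depend on the vertex order. $\mathbf{s}_i(\Phi)$ is the multiset of eigenvalues of $L_i(\Phi)$. The spectrum polynomial is the formal generating function $S_\Phi(t,q) = \sum_{i \ge 0} t^i \sum_{\lambda \in \mathbf{s}_{i-1}(\Phi)} q^\lambda$ (formal sums of $q^\lambda$ with real exponents $\lambda \ge 0$). $\Phi$ satisfies the spectral recursion with respect to $e \in E$ if $S_\Phi(t,q) = q\,S_{\Phi-e}(t,q) + qt\,S_{\Phi/e}(t,q) + (1-q)\,S_{\Phi\|e}(t,q)$. $\Phi$ satisfies the spectral recursion if it does so with respect to every vertex $e \in E$. *)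

(* Defs.v *)
From HB Require Import structures.
From mathcomp Require Import all_boot all_order all_algebra.
From mathcomp Require Import finmap reals.
From mathcomp Require Import polyrcf.
From mathcomp Require Import monalg.

Set Implicit Arguments.
Unset Strict Implicit.
Unset Printing Implicit Defensive.

Import Order.TTheory GRing.Theory Num.Theory.
Local Open Scope ring_scope.

Section Families.
Variable T : finType.
Implicit Types (Phi D : {set {set T}}) (e : T).

Definition is_interval Phi : Prop :=
  forall F G H : {set T},
    F \subset G -> G \subset H -> F \in Phi -> H \in Phi -> G \in Phi.

Definition is_complex D : Prop :=
  forall G H : {set T}, G \subset H -> H \in D -> G \in D.

Definition deletion Phi e : {set {set T}} := [set F in Phi | e \notin F].

Definition contraction Phi e : {set {set T}} :=
  [set F :\ e | F in Phi & e \in F].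

Definition star Phi e : {set {set T}} :=
  \bigcup_(F in Phi | (e \notin F) && (e |: F \in Phi)) [set F; e |: F].

Definition reduction Phi e : {set {set T}} := Phi :\: star Phi e.

End Families.

Section Shifted.
Variable E : {fset int}.
Implicit Types (Phi D F G H : {set {set E}}).

Definition increasing_listing (F : {set E}) : seq int :=
  sort <=%O [seq val x | x <- enum F].

(* [all2] is false on lists of different sizes, so only sets of the same
   cardinality are related. *)
Definition le_C (F G : {set E}) : bool :=
  all2 <=%O (increasing_listing F) (increasing_listing G).

Definition shifted_complex D : Prop :=
  is_complex D /\
  forall G H : {set E}, le_C G H -> H \in D -> G \in D.

Definition shifted_interval Phi : Prop :=
  is_interval Phi /\
  exists D D' : {set {set E}},
    [/\ shifted_complex D, shifted_complex D', D' \subset D & Phi = D :\: D'].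

End Shifted.

(* Chain groups are indexed by the cardinality k = dim + 1 of the faces, so
   that [laplacian Phi k] is L_(k-1) and [spectrum Phi k] is s_(k-1). *)
Section Spectrum.
Variables (R : realType) (E : {fset int}).
Implicit Types (Phi : {set {set E}}) (k : nat).

Definition faces Phi k : {set {set E}} := [set F in Phi | #|F| == k].

(* The position (counted from 0) of v in the increasing listing of F. *)
Definition position (v : E) (F : {set E}) : nat :=
  #|[set w in F | val w < val v]|.

(* The matrix of the boundary C_(k-1) -> C_(k-2), acting on column vectors.
   For k = 0 it goes from C_(-1) to itself (as 0.-1 = 0) and is zero, since
   the only possible face, set0, has no vertex to remove. *)
Definition boundary Phi k : 'M[R]_(#|faces Phi k.-1|, #|faces Phi k|) :=
  \matrix_(i, j)
    let G : {set E} := enum_val i in let F : {set E} := enum_val j in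
    \sum_(v in F | F :\ v == G) (-1) ^+ position v F.

Definition laplacian Phi k : 'M[R]_#|faces Phi k| :=
  boundary Phi k.+1 *m (boundary Phi k.+1)^T
    + (boundary Phi k)^T *m boundary Phi k.

(* Eigenvalues listed with their multiplicity in the characteristic
   polynomial. *)
Definition spectrum Phi k : seq R :=
  let p := char_poly (laplacian Phi k) in
  flatten [seq nseq (mup a p) a | a <- rootsR p].

Lemma spectrum_ge0 Phi k a : a \in spectrum Phi k -> 0 <= a.
Proof.
have sq_ge0 n (w : 'rV[R]_n) : 0 <= (w *m w^T) 0 0.
  by rewrite mxE sumr_ge0 // => i _; rewrite mxE -expr2 sqr_ge0.
move=> /flattenP[_ /mapP[b b_root ->]] /nseqP[-> {a} _].
have pn0 : char_poly (laplacian Phi k) != 0.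
  exact: monic_neq0 (char_poly_monic _).
have : root (char_poly (laplacian Phi k)) b.
  by have := roots_on_rootsR pn0 b; rewrite b_root => /andP[].
rewrite -eigenvalue_root_char => /eigenvalueP[v vL vn0].
have vv_gt0 : 0 < (v *m v^T) 0 0.
  rewrite lt0r sq_ge0 andbT; apply: contraNneq vn0 => vv0.
  apply/eqP/rowP => i; rewrite [RHS]mxE; apply/eqP.
  move/eqP: vv0; rewrite mxE psumr_eq0 => [/allP/(_ i)|j _].
    by rewrite mem_index_enum mxE -expr2 sqrf_eq0 => /(_ isT).
  by rewrite mxE -expr2 sqr_ge0.
rewrite -(pmulr_lge0 _ vv_gt0).
suff -> : b * (v *m v^T) 0 0 = (v *m laplacian Phi k *m v^T) 0 0.
  rewrite mulmxDr mulmxDl mxE addr_ge0 //.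
    by have := sq_ge0 _ (v *m boundary Phi k.+1);
      rewrite trmx_mul !mulmxA.
  by have := sq_ge0 _ (v *m (boundary Phi k)^T);
    rewrite trmx_mul trmxK !mulmxA.
by rewrite vL -scalemxAl [RHS]mxE.
Qed.

End Spectrum.

(* Exponents (i, a) of the monomials t^i q^a, with a a non-negative real. *)
Section Monomials.
Variable R : realType.

Definition tqmonom : Type := {x : nat * R | 0 <= x.2}.
HB.instance Definition _ := Choice.on tqmonom.
HB.instance Definition _ := SubType.on tqmonom.
Implicit Types x y z : tqmonom.

Fact tqone_subproof : 0 <= (0%N, 0 : R).2. Proof. by []. Qed.
Definition tqone : tqmonom := exist _ (0%N, 0 : R) tqone_subproof.

Fact tqmul_subproof x y :
  0 <= (((val x).1 + (val y).1)%N, (val x).2 + (val y).2).2.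
Proof. exact: addr_ge0 (valP x) (valP y). Qed.
Definition tqmul x y : tqmonom := exist _ (_, _) (tqmul_subproof x y).

Fact tqmulA : associative tqmul.
Proof. by move=> x y z; apply: val_inj; rewrite /= addnA addrA. Qed.
Fact tqmulC : commutative tqmul.
Proof. by move=> x y; apply: val_inj; rewrite /= addnC addrC. Qed.
Fact tqmul1m : left_id tqone tqmul.
Proof. by case=> -[i a] ?; apply: val_inj; rewrite /= add0n add0r. Qed.
Fact tqmulm1 : right_id tqone tqmul.
Proof. by move=> x; rewrite tqmulC tqmul1m. Qed.
Fact tqunitm x y : tqmul x y = tqone -> x = tqone /\ y = tqone.
Proof.
case: x y => -[i a] /= a0 [[j b] /= b0] /(congr1 val) [/= /eqP + /eqP].
rewrite addn_eq0 paddr_eq0 // => /andP[/eqP i0 /eqP j0] /andP[/eqP a00 /eqP b00].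
by split; apply: val_inj; rewrite /= ?i0 ?j0 ?a00 ?b00.
Qed.

HB.instance Definition _ := Choice_isMonomialDef.Build tqmonom
  tqmulA tqmul1m tqmulm1 tqunitm.
HB.instance Definition _ := MonomialDef_isConomialDef.Build tqmonom tqmulC.

(* t^i q^a; the exponent a is meant to be non-negative (a negative one is
   sent to t^0 q^0, but never arises, see [spectrum_ge0]). *)
Definition tq (i : nat) (a : R) : {malg int[tqmonom]} := << insubd tqone (i, a) >>.

End Monomials.

Section Recursion.
Variables (R : realType) (E : {fset int}).
Implicit Types (Phi : {set {set E}}) (e : E).

(* A face has at most #|E| vertices, so the terms with i > #|E| vanish. *)
Definition spectrum_poly Phi : {malg int[tqmonom R]} :=
  \sum_(i < #|{: E}|.+1) \sum_(a <- spectrum R Phi i) tq i a.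

Definition spectral_recursion_at Phi e : Prop :=
  let q := tq 0 (1 : R) in let t := tq 1 (0 : R) in
  spectrum_poly Phi =
    q * spectrum_poly (deletion Phi e)
    + q * t * spectrum_poly (contraction Phi e)
    + (1 - q) * spectrum_poly (reduction Phi e).

Definition spectral_recursion Phi : Prop :=
  forall e : E, spectral_recursion_at Phi e.

End Recursion.

(* Main.v *)
Require Import Defs.
From mathcomp Require Import all_boot all_order all_algebra all_fingroup.
From mathcomp Require Import finmap reals.
From mathcomp Require Import polyrcf monalg zify ring.

(* Write Phi_e for the faces of Phi containing e, so that t S_(Phi/e) = S_(Phi_e).

   For the least vertex m, let Q be the set of the faces F of Phi - m with
   m |: F in Phi, and P the projection on Q in one dimension.  Shiftedness gives
   a factorisation of the boundary of Phi as J W with J^T J = P + M and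
   W W^T = P + N, where M is the restriction to Q of the down-Laplacian of Phi_m
   (transported along F |-> m |: F), N the up-Laplacian of Phi - m, and M N = 0.
   Since X Y and Y X have the same nonzero spectrum, the spectrum of L(Phi) is
   that of L(Phi - m) and L(Phi_m) shifted by 1, up to as many eigenvalues 0
   instead of 1 as there are faces in Phi || m; as no two faces of Phi || m differ
   by one vertex, this is the recursion at m.

   For another vertex e one applies, by induction on the vertex set, the
   recursion at e to Phi - m and Phi_m, and the recursion at m to Phi - e, Phi_e
   and Phi || e, which are shifted on the remaining vertices; it then suffices
   that Phi || m and (Phi || e) || m have equally many faces of each size. *)

Set Implicit Arguments.
Unset Strict Implicit.
Unset Printing Implicit Defensive.

Import Order.TTheory GRing.Theory Num.Theory.
Local Open Scope ring_scope.

(** * Eigenvalue multiplicities *)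

(** Both sides are 'X^n times the determinant of [W]: a column operation clearing [B'] leaves
    [char_poly (A *m B)], and a row operation of determinant 'X^n leaves the diagonal blocks 'X and
    'X - B A. *)
Lemma char_poly_mulmxC (R : comNzRingType) m n (A : 'M[R]_(m, n)) (B : 'M_(n, m)) :
  'X^n * char_poly (A *m B) = 'X^m * char_poly (B *m A).
Proof.
pose A' := map_mx polyC A; pose B' := map_mx polyC B.
pose W : 'M[{poly R}]_(m + n) := block_mx 'X%:M A' B' 1%:M.
have WE : \det W = char_poly (A *m B).
  have <- : \det (W *m block_mx 1%:M 0 (- B') 1%:M) = char_poly (A *m B).
    rewrite mulmx_block !mulmx1 !mulmx0 !mul1mx !add0r mulmxN subrr det_ublock.
    by rewrite det1 mulr1 /char_poly /char_poly_mx map_mxM.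
  by rewrite det_mulmx det_lblock !det1 !mulr1.
have := congr1 determinant (erefl (block_mx 1%:M 0 (- B') 'X%:M *m W)).
rewrite {1}det_mulmx det_lblock det1 mul1r det_scalar WE => ->.
rewrite mulmx_block !mul1mx !mul0mx !addr0 mulmx1.
rewrite mulNmx scalar_mxC addNr det_ublock det_scalar; congr (_ * \det _).
by rewrite /char_poly_mx map_mxM mulNmx addrC.
Qed.

(** As A B = 0, the product ('X - A) ('X - B) is 'X ('X - (A + B)). *)
Lemma char_poly_add_mul0 (R : comNzRingType) n (A B : 'M[R]_n) :
  A *m B = 0 -> 'X^n * char_poly (A + B) = char_poly A * char_poly B.
Proof.
move=> AB0; rewrite /char_poly -det_mulmx -det_scalar -det_mulmx; congr (\det _).
rewrite /char_poly_mx map_mxD !mulmxBl !mulmxBr mulmxDr -map_mxM AB0 map_mx0.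
by rewrite subr0 -(scalar_mxC 'X (map_mx _ A)) opprD addrA addrAC.
Qed.

Lemma char_poly_add1 (R : comNzRingType) n (A : 'M[R]_n) :
  char_poly (1%:M + A) = char_poly A \Po ('X - 1%:P).
Proof.
rewrite /char_poly -det_map_mx; congr (\det _); apply/matrixP => i j.
rewrite !mxE /= comp_polyB comp_polyC (raddfMn (comp_poly _)) /= comp_polyX.
by rewrite polyCD rmorphMn /= opprD addrA mulrnBl.
Qed.

Section Mup.
Variable F : fieldType.
Implicit Types (p q : {poly F}) (a b : F).

Lemma mup_comp_subC a b p : mup a (p \Po ('X - b%:P)) = mup (a - b) p.
Proof.
have cn0 q c : (q \Po ('X - c%:P) == 0) = (q == 0).
  by rewrite comp_poly2_eq0 // size_XsubC.
have [->|pn0] := eqVneq p 0.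
  have mup0 c : mup c (0 : {poly F}) = 0%N.
    apply/eqP; rewrite /mup; case: arg_maxnP => [|i _ _]; rewrite ?dvdp0 //.
    by rewrite -leqn0 -ltnS -[X in (_ < X)%N]/(1%N) -(size_poly0 F).
  by rewrite comp_poly0 !mup0.
(* One inequality for all shifts suffices: the converse is the shift by - b applied to the
   composite. *)
have le p' a' b' : p' != 0 -> (mup (a' - b') p' <= mup a' (p' \Po ('X - b'%:P)))%N.
  move=> p'n0; rewrite mup_geq ?cn0 //.
  have : ('X - (a' - b')%:P) ^+ mup (a' - b') p' %| p' by rewrite -mup_geq.
  move: (mup _ p') => m /dvdpP [r ->]; rewrite comp_polyM dvdp_mull //.
  rewrite (rmorphXn (comp_poly _)) /= comp_polyB comp_polyX comp_polyC.
  by rewrite -addrA -opprD -polyCD [b' + _]addrC subrK.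
apply/eqP; rewrite eqn_leq le // andbT.
have := le (p \Po ('X - b%:P)) (a - b) (- b).
rewrite cn0 pn0 opprK subrK => /(_ isT).
rewrite -comp_polyA comp_polyB comp_polyX comp_polyC polyCN opprK addrK.
by rewrite comp_polyXr.
Qed.

Definition eigmult a n (M : 'M[F]_n) : nat := mup a (char_poly M).

Lemma char_poly_neq0 n (M : 'M[F]_n) : char_poly M != 0.
Proof. exact: monic_neq0 (char_poly_monic _). Qed.

Lemma mupXn a n : mup a ('X^n : {poly F}) = ((a == 0%R) * n)%N.
Proof.
by rewrite -['X]subr0 -[0]/(0%:P) mup_XsubCX eq_sym; case: eqP; rewrite ?mul1n.
Qed.

(** The two products differ only in the multiplicity of 0. Here and below, terms [(a == 0) * size]
    balance the sizes of the matrices, so that every identity stays additive in [nat]. *)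
Lemma eigmult_mulmxC a m n (A : 'M[F]_(m, n)) (B : 'M_(n, m)) :
  ((a == 0%R) * n + eigmult a (A *m B) = (a == 0%R) * m + eigmult a (B *m A))%N.
Proof.
have := congr1 (mup a) (char_poly_mulmxC A B).
by rewrite !mupM ?char_poly_neq0 ?monic_neq0 ?monicXn // !mupXn.
Qed.

Lemma eigmult_mulmxC_sq a n (A B : 'M[F]_n) : eigmult a (A *m B) = eigmult a (B *m A).
Proof. exact: addnI (eigmult_mulmxC a A B). Qed.

Lemma eigmult_add_mul0 a n (A B : 'M[F]_n) : A *m B = 0 ->
  ((a == 0%R) * n + eigmult a (A + B) = eigmult a A + eigmult a B)%N.
Proof.
move=> /char_poly_add_mul0/(congr1 (mup a)).
by rewrite !mupM ?char_poly_neq0 ?monic_neq0 ?monicXn // !mupXn.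
Qed.

Lemma eigmult_add1 a n (A : 'M[F]_n) : eigmult a (1%:M + A) = eigmult (a - 1) A.
Proof. by rewrite /eigmult char_poly_add1 mup_comp_subC. Qed.

Lemma eigmult0 a n : eigmult a (0 : 'M[F]_n) = ((a == 0%R) * n)%N.
Proof. by rewrite /eigmult /char_poly /char_poly_mx map_mx0 subr0 det_scalar mupXn. Qed.

End Mup.

(* Here [D = (P + C Z) (A + Z^T)], and the Gram matrices of the two factors are
   [P + M], where [M = Z^T C^T C Z], and [P + A A^T], with [M A A^T = 0]. *)
Lemma eigmult_cone (F : fieldType) n (P A C Z D : 'M[F]_n) (a : F) :
  P *m P = P -> P^T = P -> P *m A = A -> P *m C = 0 -> A *m Z = 0 ->
  Z^T *m Z = P -> Z *m P = Z -> C *m Z *m Z^T = C -> C *m Z *m A = 0 ->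
  D = A + C + Z^T ->
  ((a - 1 == 0)%R * n + eigmult a (D^T *m D) + eigmult a (1%:M - P)
   = (a == 0)%R * n + eigmult (a - 1) (C^T *m C) + eigmult (a - 1) (A *m A^T))%N.
Proof.
move=> PP trP PA PC AZ ZZ ZP CZZ CZA DE.
have ZtP : P *m Z^T = Z^T by rewrite -{1}trP -trmx_mul ZP.
have AtP : A^T *m P = A^T by rewrite -{1}trP -trmx_mul PA.
pose J := P + C *m Z; pose W := A + Z^T.
have DJW : D = J *m W.
  rewrite mulmxDl !mulmxDr PA ZtP CZA CZZ DE add0r.
  by rewrite -!addrA [C + _]addrC.
pose M := Z^T *m C^T *m C *m Z; pose K := A *m A^T.
have JJ : J^T *m J = P + M.
  rewrite /J [(P + _)^T]linearD /= trmx_mul trP mulmxDl !mulmxDr PP.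
  rewrite !mulmxA PC mul0mx addr0.
  have -> : Z^T *m C^T *m P = 0.
    by rewrite -mulmxA -{1}trP -trmx_mul PC trmx0 mulmx0.
  by rewrite add0r.
have WW : W *m W^T = P + K.
  rewrite /W [(A + _)^T]linearD /= trmxK mulmxDl !mulmxDr AZ addr0.
  have -> : Z^T *m A^T = 0 by rewrite -trmx_mul AZ trmx0.
  by rewrite add0r ZZ addrC.
have MK : M *m K = 0.
  rewrite /M /K !mulmxA -(mulmxA _ C) -(mulmxA _ (C *m Z)) CZA.
  by rewrite mulmx0 mul0mx.
have PM : P *m M = M by rewrite /M !mulmxA ZtP.
have MP : M *m P = M by rewrite /M -mulmxA ZP.
have PK : P *m K = K by rewrite /K mulmxA PA.
have KP : K *m P = K by rewrite /K -mulmxA AtP.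
(* Cyclically, W^T J^T J W has the multiplicities of J^T J W W^T = (P + M) (P + K) = P + M + K. *)
have DD : eigmult a (D^T *m D) = eigmult a (P + M + K).
  rewrite DJW trmx_mul -mulmxA eigmult_mulmxC_sq -!mulmxA WW !mulmxA JJ.
  by rewrite mulmxDl !mulmxDr PP PK MP MK addr0 addrAC.
have CM : eigmult (a - 1) (C^T *m C) = eigmult (a - 1) M.
  by rewrite /M -!mulmxA [RHS]eigmult_mulmxC_sq -!mulmxA (mulmxA C) CZZ.
(* Adding the complement 1 - P completes P to the identity, which makes the shift by 1 available. *)
have := @eigmult_add_mul0 F a n (P + M + K) (1%:M - P).
rewrite mulmxBr mulmx1 !mulmxDl PP MP KP subrr => /(_ erefl).
have -> : P + M + K + (1%:M - P) = 1%:M + (M + K).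
  by rewrite addrC -addrA; congr (_ + _); rewrite -addrA addKr.
rewrite eigmult_add1 => e1; have := eigmult_add_mul0 (a - 1) MK.
rewrite DD CM -/K; move: e1; move: (_ * n)%N (_ * n)%N => x y e1 e2.
by rewrite -addnA -e1 addnCA e2 addnA.
Qed.

(** * Boundary operators *)

Lemma setD1C (T : finType) (A : {set T}) x y : A :\ x :\ y = A :\ y :\ x.
Proof. by rewrite !setDDl setUC. Qed.

Section Monomial.
Variables (R : comNzRingType) (T : finType).
Implicit Types (g h : T -> T) (c d : T -> R) (S : {set T}).

(** At most one nonzero entry per column: operator identities reduce to identities between set maps
    and coefficients. *)
Definition mono g c : 'M[R]_#|T| :=
  \matrix_(i, j) ((enum_val i == g (enum_val j))%:R * c (enum_val j)).

Definition proj S : 'M[R]_#|T| := mono id (fun x => (x \in S)%:R).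

Lemma mono_mul g c h d :
  mono g c *m mono h d = mono (g \o h) (fun x => c (h x) * d x).
Proof.
apply/matrixP => i j; rewrite !mxE (bigD1 (enum_rank (h (enum_val j)))) //=.
rewrite !mxE enum_rankK eqxx mul1r big1 ?addr0 ?mulrA // => k.
by rewrite -(inj_eq enum_val_inj) enum_rankK !mxE => /negbTE->; rewrite mul0r mulr0.
Qed.

Lemma eq_mono g c h d :
  (forall x, c x = d x) -> (forall x, c x != 0 -> g x = h x) -> mono g c = mono h d.
Proof.
move=> cd gh; apply/matrixP => i j; rewrite !mxE -cd.
by have [->|/gh->] := eqVneq (c (enum_val j)) 0; rewrite ?mulr0.
Qed.

Lemma mono_add g c d : mono g c + mono g d = mono g (fun x => c x + d x).
Proof. by apply/matrixP => i j; rewrite !mxE mulrDr. Qed.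

Lemma mono_eq0 g c : (forall x, c x = 0) -> mono g c = 0.
Proof. by move=> c0; apply/matrixP => i j; rewrite !mxE c0 mulr0. Qed.

Lemma trmx_mono g c h d :
  (forall x y, (x == g y)%:R * c y = (y == h x)%:R * d x) ->
  (mono g c)^T = mono h d.
Proof. by move=> gh; apply/matrixP => i j; rewrite !mxE gh. Qed.

Lemma trmx_proj S : (proj S)^T = proj S.
Proof.
by apply: trmx_mono => x y /=; rewrite eq_sym; case: eqP => [->|]; rewrite ?mul0r.
Qed.

Lemma proj_projE S S' : proj S *m proj S' = proj (S :&: S').
Proof.
by rewrite mono_mul; apply: eq_mono => x //=; rewrite inE -natrM mulnb.
Qed.

Lemma proj_idem S : proj S *m proj S = proj S.
Proof. by rewrite proj_projE setIid. Qed.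

Lemma proj_setT : proj [set: T] = 1%:M.
Proof.
apply/matrixP => i j; rewrite !mxE in_setT mulr1 (inj_eq enum_val_inj).
by case: eqP.
Qed.

End Monomial.

Section Ops.
Variables (R : realType) (E : {fset int}).
Implicit Types (u v e m : E) (F G : {set E}) (V : {set E}).

Local Notation mono := (@mono R {set E}).
Local Notation proj := (@proj R {set E}).

Definition sgn v F : R := (-1) ^+ position v F.

Lemma sgn_sq v F : sgn v F * sgn v F = 1.
Proof. by rewrite -expr2 sqrr_sign. Qed.

Lemma positionD1 u v F :
  position v F = ((u \in F) && (val u < val v)%R + position v (F :\ u))%N.
Proof.
rewrite /position (cardsD1 u) !inE; congr (_ + #|pred_of_set _|)%N.
by apply/setP => w; rewrite !inE andbA.
Qed.

Lemma sgnD1 u v F : u \in F -> sgn v F = (-1) ^+ (val u < val v)%R * sgn v (F :\ u).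
Proof. by move=> uF; rewrite /sgn (positionD1 u) uF exprD. Qed.

Lemma sgnU1 u v F : u \notin F ->
  sgn v (u |: F) = (-1) ^+ (val u < val v)%R * sgn v F.
Proof. by move=> uF; rewrite (@sgnD1 u) ?setU11 // setU1K. Qed.

Lemma sgnU1_id v F : sgn v (v |: F) = sgn v F.
Proof.
have [vF|vF] := boolP (v \in F); first by rewrite (setUidPr _) ?sub1set.
by rewrite sgnU1 // ltxx mul1r.
Qed.

(* Signed removal and insertion of a vertex: annihilation and creation operators,
   subject to the canonical anticommutation relations. *)
Definition ann v := mono (fun F => F :\ v) (fun F => (v \in F)%:R * sgn v F).
Definition cre v := mono (fun F => v |: F) (fun F => (v \notin F)%:R * sgn v F).

Lemma trmx_ann v : (ann v)^T = cre v.
Proof.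
apply: trmx_mono => G F.
have [->|nGF] /= := eqVneq G (F :\ v).
  rewrite !inE eqxx mul1r; have [vF|vF] := boolP (v \in F).
    by rewrite setD1K // eqxx !mul1r -[in LHS](setD1K vF) sgnU1_id.
  rewrite mul0r; have [FE|] := eqVneq F; rewrite ?mul0r //.
  by rewrite FE setU11 in vF.
rewrite mul0r; have [FE|] /= := eqVneq F (v |: G); last by rewrite mul0r.
have [vG|vG] /= := boolP (v \in G); rewrite ?mul0r ?mulr0 //.
by rewrite FE setU1K ?eqxx in nGF.
Qed.

Lemma sign_lt_flip u v : u != v ->
  (-1) ^+ (val u < val v)%R = - (-1) ^+ (val v < val u)%R :> R.
Proof.
move=> uv; have : val u != val v by rewrite (inj_eq val_inj).
by case: ltgtP => //= _ _; rewrite ?expr0 ?expr1 ?opprK.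
Qed.

(** Both orders reach the same face; removing the smaller vertex first shifts the position of the
    larger one, and not conversely, whence opposite signs. *)
Lemma ann_ann u v : ann u *m ann v + ann v *m ann u = 0.
Proof.
rewrite !mono_mul.
rewrite [X in _ + X](@eq_mono _ _ _ _ ((fun F => F :\ u) \o (fun F => F :\ v))
  (fun F => (v \in F :\ u)%:R * sgn v (F :\ u) * ((u \in F)%:R * sgn u F))) //;
  last by move=> F _; apply: setD1C.
rewrite mono_add; apply: mono_eq0 => F; rewrite !inE.
have [->|uv] := eqVneq u v; first by rewrite /= !mul0r addr0.
move=> /=; have [uF|] := boolP (u \in F); have [vF|] := boolP (v \in F);
  rewrite ?(mul1r, mul0r, mulr0, addr0) //.
rewrite (sgnD1 v uF) (sgnD1 u vF) sign_lt_flip //.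
ring.
Qed.

Lemma ann_cre u v :
  ann u *m cre v + cre v *m ann u = if u == v then 1%:M else 0.
Proof.
rewrite !mono_mul; have [->|uv] := eqVneq u v.
  (* For u = v the two products are the projections on the sets without v and with v. *)
  rewrite -proj_setT (@eq_mono _ _ _ _ id (fun F => (v \notin F)%:R)).
  - rewrite (@eq_mono _ _ (_ \o _) _ id (fun F => (v \in F)%:R)).
    + rewrite mono_add; apply: eq_mono => F // .
      by rewrite in_setT; case: (v \in F); rewrite ?addr0 ?add0r.
    + move=> F; rewrite !inE eqxx /= mul1r.
      case: (boolP (v \in F)) => vF; rewrite ?(mul0r, mulr0) //.
      by rewrite mul1r -{2}(setD1K vF) sgnU1_id sgn_sq.
    + move=> F /=; case: (boolP (v \in F)) => vF; first by rewrite setD1K.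
      by rewrite !(mul0r, mulr0) eqxx.
  - move=> F; rewrite setU11 sgnU1_id mul1r.
    case: (v \in F); rewrite ?(mul0r, mulr0) //.
    by rewrite mul1r sgn_sq.
  - move=> F /=; case: (boolP (v \in F)) => vF; last by rewrite setU1K.
    by rewrite !(mul0r, mulr0) eqxx.
rewrite [X in _ + X](@eq_mono _ _ _ _ ((fun F => F :\ u) \o (fun F => v |: F))
  (fun F => (v \notin F :\ u)%:R * sgn v (F :\ u) * ((u \in F)%:R * sgn u F))) //;
  last first.
  move=> F _; apply/setP => w /=; rewrite !inE; case: (eqVneq w v) => // ->.
  by rewrite eq_sym uv.
rewrite mono_add; apply: mono_eq0 => F.
rewrite !inE (negbTE uv) [v == u]eq_sym (negbTE uv) /=.
case: (boolP (v \in F)) => vF; rewrite ?(mul0r, mulr0, addr0) //.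
case: (boolP (u \in F)) => uF; rewrite ?(mul0r, mulr0, addr0) //.
rewrite !mul1r sgnU1 // (sgnD1 v uF) (sign_lt_flip uv).
by case: (_ < _)%R; rewrite ?expr0 ?expr1; ring.
Qed.

Definition bd V : 'M[R]_#|{set E}| := \sum_(v in V) ann v.

(** Exchanging the two summation indices gives the negative, by anticommutation. *)
Lemma bd_square V : bd V *m bd V = 0.
Proof.
have E2 : bd V *m bd V = \sum_(u in V) \sum_(v in V) ann u *m ann v.
  by rewrite mulmx_suml; apply: eq_bigr => u _; rewrite mulmx_sumr.
have : bd V *m bd V = - (bd V *m bd V).
  rewrite {1}E2 exchange_big E2 -sumrN; apply: eq_bigr => v _.
  rewrite -sumrN; apply: eq_bigr => u _.
  by apply/eqP; rewrite -addr_eq0 ann_ann.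
by move/eqP; rewrite -addr_eq0 -mulr2n -scaler_nat scaler_eq0 pnatr_eq0 => /eqP.
Qed.

(** Coning with apex m is a contracting homotopy. *)
Lemma bd_cre V m : m \in V -> bd V *m cre m + cre m *m bd V = 1%:M.
Proof.
move=> mV; rewrite mulmx_suml mulmx_sumr -big_split /= (bigD1 m) //= ann_cre eqxx.
by rewrite big1 ?addr0 // => u /andP[_ /negbTE um]; rewrite ann_cre um.
Qed.

End Ops.

(** * Coordinate inclusions, and Laplacians extended by zero *)

Section Inclusion.
Variables (R : comNzRingType) (T : finType).
Implicit Types (S : {set T}).

Definition incl S : 'M[R]_(#|T|, #|S|) :=
  \matrix_(i, j) (enum_val i == enum_val j :> T)%:R.

Lemma trmx_mul_incl S : (incl S)^T *m incl S = 1%:M.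
Proof.
apply/matrixP => i j; rewrite !mxE (bigD1 (enum_rank (enum_val i))) //=.
rewrite !mxE enum_rankK eqxx mul1r (inj_eq enum_val_inj) big1 ?addr0 // => x.
by rewrite -(inj_eq enum_val_inj) enum_rankK !mxE => /negbTE->; rewrite mul0r.
Qed.

Lemma mul_incl_tr S : incl S *m (incl S)^T = proj R S.
Proof.
apply/matrixP => i j; rewrite !mxE; have [iS|iS] := boolP (enum_val j \in S).
  rewrite (bigD1 (enum_rank_in iS (enum_val j))) //= !mxE enum_rankK_in // eqxx !mulr1.
  rewrite big1 ?addr0 // => x; rewrite !mxE => /eqP xN.
  have [ij|] := eqVneq (enum_val j) (enum_val x :> T); last by rewrite mulr0.
  by case: xN; apply: enum_val_inj; rewrite enum_rankK_in // ij.
rewrite mulr0 big1 // => x _; rewrite !mxE.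
have [ij|] := eqVneq (enum_val j) (enum_val x :> T); last by rewrite mulr0.
by rewrite ij enum_valP in iS.
Qed.

Lemma tr_incl_mulE S S' (M : 'M_#|T|) i j :
  ((incl S)^T *m M *m incl S') i j
  = M (enum_rank (enum_val i)) (enum_rank (enum_val j)).
Proof.
rewrite !mxE (bigD1 (enum_rank (enum_val j))) //= !mxE enum_rankK eqxx mulr1.
rewrite [X in _ + X]big1 ?addr0.
  rewrite (bigD1 (enum_rank (enum_val i))) //= !mxE enum_rankK eqxx mul1r.
  rewrite big1 ?addr0 // => x.
  by rewrite -(inj_eq enum_val_inj) enum_rankK !mxE => /negbTE->; rewrite mul0r.
move=> x.
by rewrite -(inj_eq enum_val_inj) enum_rankK !mxE => /negbTE->; rewrite mulr0.
Qed.

End Inclusion.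

Section Total.
Variables (R : realType) (E : {fset int}).
Implicit Types (u v e m : E) (F G : {set E}) (V : {set E}) (Phi : {set {set E}}).

Local Notation mono := (@mono R {set E}).
Local Notation proj := (@proj R {set E}).
Local Notation ann := (@ann R E).
Local Notation cre := (@cre R E).
Local Notation bd := (@bd R E).
Local Notation sgn := (@sgn R E).

(* Boundary and Laplacian as endomorphisms of the space on all subsets of [E], zero
   outside the faces of [Phi]; this only adds eigenvalues 0 and makes the operators
   of different families composable. *)
Definition full_boundary Phi k := proj Phi *m bd [set: E] *m proj (faces Phi k).

Definition full_laplacian Phi k :=
  full_boundary Phi k.+1 *m (full_boundary Phi k.+1)^T
    + (full_boundary Phi k)^T *m full_boundary Phi k.

Lemma proj_annE (S S' : {set {set E}}) v :
  proj S *m ann v *m proj S' =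
  mono (fun F => F :\ v)
       (fun F => [&& F \in S', v \in F & F :\ v \in S]%:R * sgn v F).
Proof.
rewrite !mono_mul; apply: eq_mono => F //=.
by do 3!case: (_ \in _) => /=; rewrite ?(mul0r, mul1r, mulr0, mulr1).
Qed.

Lemma proj_bdE (S S' : {set {set E}}) V :
  proj S *m bd V *m proj S' = \sum_(v in V) proj S *m ann v *m proj S'.
Proof. by rewrite mulmx_sumr mulmx_suml. Qed.

(** A face that loses a vertex goes from size k to [k.-1]; for k = 0 both sides vanish, the empty
    set having no vertex to lose. *)
Lemma full_boundary_faces Phi k :
  full_boundary Phi k = proj (faces Phi k.-1) *m bd [set: E] *m proj (faces Phi k).
Proof.
rewrite /full_boundary !proj_bdE; apply: eq_bigr => v _; rewrite !proj_annE.
apply: eq_mono => F //; congr ((nat_of_bool _)%:R * _); rewrite !inE.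
case: (boolP (v \in F)) => vF; rewrite ?andbF //=.
have := cardsD1 v F; rewrite vF add1n => ->.
by case: eqP => [<-|]; rewrite ?eqxx ?andbT ?andbF.
Qed.

Lemma boundaryE Phi k :
  boundary R Phi k =
  (incl R (faces Phi k.-1))^T *m bd [set: E] *m incl R (faces Phi k).
Proof.
apply/matrixP => i j; rewrite tr_incl_mulE mxE summxE /=.
under [RHS]eq_bigr do rewrite mxE !enum_rankK mulrA.
rewrite big_mkcond /=; apply: eq_big => v; rewrite ?inE // => _.
by rewrite eq_sym -natrM mulnb andbC; case: ifP => _; rewrite ?mul0r ?mul1r.
Qed.

Lemma full_laplacian_incl Phi k :
  full_laplacian Phi k =
  incl R (faces Phi k) *m laplacian R Phi k *m (incl R (faces Phi k))^T.
Proof.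
rewrite /full_laplacian !full_boundary_faces /laplacian !boundaryE.
rewrite !trmx_mul !trmxK !trmx_proj !mulmxA.
have idem n1 (M : 'M_(n1, _)) S : M *m proj S *m proj S = M *m proj S.
  by rewrite -mulmxA proj_idem.
by rewrite !idem -!mul_incl_tr mulmxDr mulmxDl !mulmxA.
Qed.

Lemma eigmult_full_laplacian a Phi k :
  ((a == 0%R) * #|faces Phi k| + eigmult a (full_laplacian Phi k)
   = (a == 0%R) * #|{: {set E}}| + eigmult a (laplacian R Phi k))%N.
Proof.
by rewrite full_laplacian_incl -mulmxA eigmult_mulmxC -mulmxA trmx_mul_incl mulmx1.
Qed.

Lemma count_spectrum a Phi k :
  count_mem a (spectrum R Phi k) = eigmult a (laplacian R Phi k).
Proof.
rewrite /spectrum /eigmult; set p := char_poly _.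
have pn0 : p != 0 by exact: char_poly_neq0.
rewrite count_flatten -map_comp sumnE big_map.
rewrite (eq_bigr (fun b => if b == a then mup a p else 0%N)); last first.
  by move=> b _ /=; rewrite count_nseq /=; case: eqP => [->|]; rewrite ?mul1n ?mul0n.
rewrite -big_mkcond big_const_seq iter_addn_0 count_uniq_mem ?uniq_roots //.
have [_|aN] := boolP (a \in _); rewrite ?muln1 //.
rewrite muln0 mupNroot //; apply: contra aN => ap.
by have := roots_on_rootsR pn0 a; rewrite in_itv /= ap => <-.
Qed.

Definition in_boundary V Phi :=
  forall F v, F \in Phi -> v \in F -> F :\ v \in Phi -> v \in V.

Lemma full_boundary_restrict V Phi k : in_boundary V Phi ->
  full_boundary Phi k = proj Phi *m bd V *m proj (faces Phi k).
Proof.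
move=> bV; rewrite /full_boundary !proj_bdE [RHS]big_mkcond /=.
apply: eq_big => v; rewrite ?inE // => _.
case: ifP => // vV; rewrite proj_annE mono_eq0 // => F.
case: and3P => [[]|]; rewrite ?mul0r // inE => /andP[FP _] vF FvP.
by rewrite (bV F v) in vV.
Qed.

Lemma sandwich V (S S' : {set {set E}}) (M : 'M_#|{set E}|) :
  proj S *m bd V *m M *m bd V *m proj S' =
  \sum_(u in V) \sum_(v in V) proj S *m ann u *m M *m ann v *m proj S'.
Proof.
rewrite mulmx_sumr mulmx_suml exchange_big; apply: eq_bigr => v _.
by rewrite mulmx_sumr !mulmx_suml.
Qed.

(** Comparison with [bd V *m bd V = 0]: the inserted projection changes nothing when every two-step
    removal from S' to S passes through S1. *)
Lemma bd_mid_bd V (S S1 S' : {set {set E}}) :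
    (forall F u v, u \in V -> v \in V -> F \in S' -> v \in F -> u \in F :\ v ->
       F :\ v :\ u \in S -> F :\ v \in S1) ->
  proj S *m bd V *m proj S1 *m bd V *m proj S' = 0.
Proof.
move=> S1P; transitivity (proj S *m bd V *m 1%:M *m bd V *m proj S'); last first.
  by rewrite mulmx1 -[_ *m bd V *m bd V]mulmxA bd_square mulmx0 mul0mx.
rewrite -proj_setT !sandwich; apply: eq_bigr => u uV; apply: eq_bigr => v vV.
rewrite !mono_mul; apply: eq_mono => F //=; rewrite in_setT.
have := S1P F u v uV vV; rewrite [in u \in F :\ v]/=.
case: (F \in S') => /= [/(_ isT)|_]; last by rewrite !mulr0.
case: (v \in F) => /= [/(_ isT)|_]; last by rewrite !(mul0r, mulr0).
case: (u \in F :\ v) => /= [/(_ isT)|_]; last by rewrite !(mul0r, mulr0).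
by case: (F :\ v :\ u \in S) => /= [/(_ isT) ->|_]; rewrite ?mul0r.
Qed.

(** Without the inner projections, the homotopy formula gives bd cre bd = bd, whose compression
    vanishes because no removal leads from a set without m to one with m. The hypothesis makes the
    projections harmless; u = m may be ignored, since the result would miss m. *)
Lemma bd_cre_bd V m (S S1 S2 S' : {set {set E}}) : m \in V ->
    (forall F, F \in S -> m \in F) -> (forall F, F \in S' -> m \notin F) ->
    (forall F u v, u \in V -> v \in V -> F \in S' -> v \in F ->
       u \in m |: F :\ v -> u != m -> (m |: F :\ v) :\ u \in S ->
       (F :\ v \in S2) && (m |: F :\ v \in S1)) ->
  proj S *m bd V *m (proj S1 *m cre m *m proj S2) *m bd V *m proj S' = 0.
Proof.
move=> mV Sm S'm SP.
transitivity (proj S *m bd V *m cre m *m bd V *m proj S'); last first.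
  have -> : proj S *m bd V *m cre m = proj S *m (1%:M - cre m *m bd V).
    by rewrite -mulmxA -(@bd_cre R E V m mV) addrK.
  rewrite mulmxBr mulmx1 mulmxBl -(mulmxA (proj S)) -(mulmxA (cre m)) bd_square.
  rewrite !mulmx0 subr0.
  rewrite proj_bdE big1 // => v vV; rewrite proj_annE mono_eq0 // => F.
  case: and3P => [[FS' vF /Sm]|]; rewrite ?mul0r // !inE.
  by rewrite (negbTE (S'm _ FS')) andbF.
rewrite !sandwich; apply: eq_bigr => u uV; apply: eq_bigr => v vV.
rewrite !mulmxA !mono_mul; apply: eq_mono => F //=.
have := SP F u v uV vV.
case: (boolP (F \in S')) => /= [FS' /(_ isT)|_ _]; last by rewrite !mulr0.
case: (v \in F) => /= [/(_ isT)|_]; last by rewrite !(mul0r, mulr0).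
case: (u \in m |: F :\ v) => /= [/(_ isT)|_]; last by rewrite !(mul0r, mulr0).
have [um _|um /(_ isT)] := eqVneq u m.
  have [/Sm|_] := boolP ((m |: F :\ v) :\ u \in S); last by rewrite !mul0r.
  by rewrite !inE um eqxx.
case: (boolP (_ \in S)) => [_ /(_ isT) /andP[-> ->]|_ _]; last by rewrite !mul0r.
by rewrite ?(mulr1, mul1r).
Qed.

End Total.

(** * Shifted families *)

Section ShiftedOn.
Variable E : {fset int}.
Implicit Types (u v e m : E) (F G : {set E}) (V : {set E}) (D Phi : {set {set E}}).

Definition star_part Phi e : {set {set E}} := [set F in Phi | e \in F].

(* Only the vertices in [V] can be removed or exchanged; the others are carried
   along, so that [star_part Phi e] plays the role of the contraction [Phi/e]
   without any change of faces. *)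
Definition shift_closed V D :=
  (forall v F, v \in V -> F \in D -> F :\ v \in D) /\
  (forall u v F, u \in V -> v \in V -> (val u < val v)%R ->
     v \in F -> u \notin F -> F \in D -> u |: F :\ v \in D).

Definition shifted_on V Phi :=
  in_boundary V Phi /\
  exists D D', [/\ shift_closed V D, shift_closed V D' & Phi = D :\: D'].

Lemma in_reduction Phi e F :
  (F \in reduction Phi e) =
  (F \in Phi) && ((if e \in F then F :\ e else e |: F) \notin Phi).
Proof.
rewrite inE andbC; apply: andb_id2l => FP; congr negb.
apply/bigcupP/idP => [[G /and3P[GP eG eGP]]|].
  rewrite !inE => /orP[/eqP->|/eqP->]; first by rewrite (negbTE eG).
  by rewrite setU11 setU1K.
case: ifPn => eF TP.
  by exists (F :\ e); rewrite !inE ?eqxx ?setD1K ?TP ?FP ?eqxx ?orbT.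
by exists F; rewrite ?inE ?eqxx ?FP ?eF.
Qed.

Section Minimum.
Variables (V : {set E}) (m : E) (Phi : {set {set E}}).
Hypotheses (mV : m \in V) (minV : forall v, v \in V -> (val m <= val v)%R).
Hypothesis shP : shifted_on V Phi.

Let min_lt v : v \in V -> v != m -> (val m < val v)%R.
Proof.
move=> vV vm; rewrite lt_neqAle minV // andbT.
by rewrite (inj_eq val_inj) eq_sym.
Qed.

Lemma shifted_interval_on F u v : u \in V -> v \in V -> F \in Phi ->
  F :\ v :\ u \in Phi -> F :\ v \in Phi.
Proof.
have [_ [D [D' [[cD _] [cD' _] ->]]]] := shP.
move=> uV vV; rewrite !inE => /andP[_ FD] /andP[FuD' _].
rewrite cD // andbT; apply: contra FuD'; exact: cD'.
Qed.

(** Exchanging v for m stays in D, and a result in D' would put F minus v in D'. This makes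
    boundaries in the deletion land in Q. *)
Lemma min_cover F v : F \in Phi -> m \notin F -> v \in F -> F :\ v \in Phi ->
  m |: F :\ v \in Phi.
Proof.
move=> FP mF vF FvP; have [bP [D [D' [[_ xD] [cD' _] PE]]]] := shP.
have vV := bP _ _ FP vF FvP.
have vm : v != m by apply: contraNneq mF => <-.
move: FP FvP; rewrite PE !inE => /andP[_ FD] /andP[FvD' _].
rewrite xD ?min_lt // andbT; apply: contra FvD' => /(cD' m _ mV).
by rewrite setU1K // !inE negb_and mF orbT.
Qed.

(** If F minus m were in D', exchanging v for m would put F minus v there. So a face of the star
    part with a nonzero boundary comes from Q. *)
Lemma min_link F v : F \in Phi -> m \in F -> v \in F -> v != m ->
  F :\ v \in Phi -> F :\ m \in Phi.
Proof.
move=> FP mF vF vm FvP; have [bP [D [D' [[cD _] [_ xD'] PE]]]] := shP.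
have vV := bP _ _ FP vF FvP.
move: FP FvP; rewrite PE !inE => /andP[_ FD] /andP[FvD' _].
rewrite cD // andbT; apply: contra FvD' => FmD'.
have := xD' m v _ mV vV (min_lt vV vm) _ _ FmD'.
rewrite !inE vm vF eqxx => /(_ isT isT).
suff -> : m |: F :\ m :\ v = F :\ v by [].
by rewrite setD1C setD1K // !inE eq_sym vm.
Qed.

(** If F minus v were in D', exchanging u for m would put the last face there; [min_cover] gives the
    other half. These are the intermediate faces that [bd_cre_bd] asks for. *)
Lemma min_between F u v : u \in V -> v \in V -> F \in Phi -> m \notin F ->
  v \in F -> u \in F :\ v -> m |: (F :\ v :\ u) \in Phi ->
  (F :\ v \in Phi) && (m |: F :\ v \in Phi).
Proof.
move=> uV vV FP mF vF uF GP.
have uFF : u \in F by case/setD1P: uF.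
have [bP [D [D' [[cD xD] [cD' xD'] PE]]]] := shP.
have vm : v != m by apply: contraNneq mF => <-.
have um : u != m by apply: contraNneq mF => <-.
suff FvP : F :\ v \in Phi by rewrite FvP min_cover.
move: FP GP; rewrite PE !inE => /andP[_ FD] /andP[GD' _].
rewrite cD // andbT; apply: contra GD' => FvD'.
by rewrite xD' ?min_lt // !inE negb_and mF orbT.
Qed.

(** If both sets were in Phi, [min_link] (m in F) or [min_cover] (m not in F) would put one of them
    in the star of m. Hence all boundaries of the reduction vanish. *)
Lemma reduction_min_free F v : F \in reduction Phi m -> v \in F ->
  F :\ v \notin reduction Phi m.
Proof.
rewrite !in_reduction => /andP[FP FN] vF; apply/negP => /andP[FvP].
move: FN; case: ifPn => mF.
  move=> FmP _; have [vm|vm] := eqVneq v m; first by rewrite -vm FvP in FmP.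
  by rewrite (min_link FP mF vF vm FvP) in FmP.
by move=> _; rewrite !inE (negbTE mF) andbF (min_cover FP mF vF FvP).
Qed.

End Minimum.

(** Moves on the vertices other than e do not affect the membership of e. *)
Lemma shift_closed_slice V D e (p : pred bool) : shift_closed V D ->
  shift_closed (V :\ e) [set F in D | p (e \in F)].
Proof.
move=> [cD xD]; split=> [v F|u v F].
  rewrite !inE => /andP[ve vV] /andP[FD pF].
  by rewrite cD // eq_sym ve.
rewrite !inE => /andP[ue uV] /andP[ve vV] uv vF uF /andP[FD pF].
by rewrite xD // [e == u]eq_sym [e == v]eq_sym (negbTE ue) ve.
Qed.

Lemma shifted_on_deletion V Phi e : shifted_on V Phi ->
  shifted_on (V :\ e) (deletion Phi e).
Proof.
move=> [bP [D [D' [cD cD' PE]]]]; split=> [F v|].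
  rewrite !inE => /andP[FP eF] vF /andP[FvP _].
  by rewrite (bP _ _ FP vF FvP) andbT; apply: contraNneq eF => <-.
exists [set F in D | ~~ (e \in F)], [set F in D' | ~~ (e \in F)].
split; [exact: shift_closed_slice negb _|exact: shift_closed_slice negb _|].
by apply/setP => F; rewrite PE !inE; case: (e \in F); rewrite ?(andbT, andbF).
Qed.

Lemma shifted_on_star V Phi e : shifted_on V Phi ->
  shifted_on (V :\ e) (star_part Phi e).
Proof.
move=> [bP [D [D' [cD cD' PE]]]]; split=> [F v|].
  rewrite !inE => /andP[FP eF] vF /andP[FvP /andP[ev _]].
  by rewrite (bP _ _ FP vF FvP) andbT eq_sym.
exists [set F in D | e \in F], [set F in D' | e \in F].
split; [exact: shift_closed_slice id _|exact: shift_closed_slice id _|].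
by apply/setP => F; rewrite PE !inE; case: (e \in F); rewrite ?(andbT, andbF).
Qed.

Lemma shifted_on_reduction V Phi e : e \in V -> shifted_on V Phi ->
  shifted_on (V :\ e) (reduction Phi e).
Proof.
move=> eV [bP [D [D' [[cD xD] [cD' xD'] PE]]]]; split=> [F v|].
  rewrite !in_reduction !inE => /andP[FP FN] vF /andP[FvP _].
  rewrite (bP _ _ FP vF FvP) andbT; apply: contraTneq FN => <-.
  by rewrite vF FvP.
have U1D1 F v : v != e -> e |: F :\ v = (e |: F) :\ v.
  move=> ve; apply/setP => w; rewrite !inE; case: (eqVneq w e) => // ->.
  by rewrite eq_sym ve.
(* A face F with e survives when F minus e, which lies in D, is in D'. A face F without e survives
   when e |: F, which cannot be in D', is outside D. *)
exists [set F in D | (e \in F) ==> (F :\ e \in D')].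
exists [set F : {set E} | (F \in D') || (e \notin F) && (e |: F \in D)].
split; first split=> [v F|u v F].
- rewrite !inE => /andP[ve vV] /andP[FD FeD']; rewrite cD //= eq_sym ve /=.
  apply/implyP => eF; move: FeD'; rewrite eF /= => FeD'.
  by rewrite setD1C cD'.
- rewrite !inE => /andP[ue uV] /andP[ve vV] uv vF uF /andP[FD FeD'].
  rewrite xD //= eq_sym (negbTE ue) [e == v]eq_sym ve /=.
  apply/implyP => eF; move: FeD'; rewrite eF /= => FeD'.
  suff -> : (u |: F :\ v) :\ e = u |: F :\ e :\ v.
    by apply: xD' => //; rewrite !inE ?ve // negb_and uF orbT.
  apply/setP => w; rewrite !inE; case: (eqVneq w u) => [->|_] /=; first by rewrite ue.
  by rewrite andbCA.
- split=> [v F|u v F].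
    rewrite !inE => /andP[ve vV] /orP[FD'|/andP[eF FeD]]; first by rewrite cD'.
    by rewrite negb_and eF orbT U1D1 // cD ?orbT.
  rewrite !inE => /andP[ue uV] /andP[ve vV] uv vF uF /orP[FD'|/andP[eF FeD]].
    by rewrite xD'.
  rewrite eq_sym negb_or ue negb_and eF orbT /=.
  suff -> : e |: (u |: F :\ v) = u |: (e |: F) :\ v.
    by rewrite xD ?orbT // !inE ?vF ?orbT // negb_or ue.
  by rewrite setUCA U1D1.
apply/setP => F; rewrite in_reduction PE !inE.
case: (boolP (e \in F)) => eF /=.
  rewrite orbF; case: (boolP (F \in D)) => FD; rewrite ?(andbF, andbT) //=.
  by rewrite cD //= andbT negbK.
rewrite !andbT negb_or negb_and negbK; case: (boolP (F \in D')) => FD' //=.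
case: (boolP (F \in D)) => FD; rewrite ?andbF //= ?andbT.
case: (boolP (e |: F \in D')) => // eFD'.
by move: (cD' _ _ eV eFD'); rewrite setU1K // (negbTE FD').
Qed.

End ShiftedOn.

(** * The recursion at the least vertex *)

Lemma eigmult_proj (R : fieldType) (T : finType) (a : R) (S : {set T}) :
  (eigmult a (proj R S) + (a == 0%R) * #|S|
   = (a == 0%R) * #|T| + (a - 1 == 0)%R * #|S|)%N.
Proof.
rewrite -mul_incl_tr addnC eigmult_mulmxC trmx_mul_incl -[1%:M]addr0.
by rewrite eigmult_add1 eigmult0.
Qed.

Section Minimum.
Variables (R : realType) (E : {fset int}).
Implicit Types (u v e : E) (F G : {set E}).
Local Notation proj := (@proj R {set E}).
Local Notation mono := (@mono R {set E}).
Local Notation ann := (@ann R E).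
Local Notation cre := (@cre R E).
Local Notation sgn := (@sgn R E).
Local Notation full_boundary := (@full_boundary R E).

Lemma full_boundary_sq V (Phi : {set {set E}}) k : shifted_on V Phi ->
  full_boundary Phi k *m full_boundary Phi k.+1 = 0.
Proof.
move=> shP; have [bP _] := shP.
rewrite !(full_boundary_restrict R _ bP) !mulmxA.
rewrite -(mulmxA _ (proj (faces Phi k))) proj_projE.
apply: bd_mid_bd => F u v uV vV; rewrite !inE => /andP[FP /eqP Fk] vF uF GP.
rewrite (shifted_interval_on shP uV vV FP GP) andbT /=.
by rewrite -eqSS -Fk (cardsD1 v F) vF.
Qed.

(** Consecutive boundaries compose to 0, so the two summands of the Laplacian have product 0 and
    their multiplicities add up. *)
Lemma eigmult_full_laplacian_split a V (Phi : {set {set E}}) k : shifted_on V Phi ->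
  ((a == 0%R) * #|{: {set E}}| + eigmult a (full_laplacian R Phi k)
   = eigmult a (full_boundary Phi k.+1 *m (full_boundary Phi k.+1)^T)
     + eigmult a ((full_boundary Phi k)^T *m full_boundary Phi k))%N.
Proof.
move=> shP; rewrite eigmult_add_mul0 // -mulmxA (mulmxA _^T) -trmx_mul.
by rewrite (full_boundary_sq k shP) trmx0 mul0mx mulmx0.
Qed.

Variables (V : {set E}) (m : E) (Phi : {set {set E}}).
Hypotheses (mV : m \in V) (minV : forall v, v \in V -> (val m <= val v)%R).
Hypothesis shP : shifted_on V Phi.

Let bP : in_boundary V Phi. Proof. by case: shP. Qed.
Let Del := deletion Phi m.
Let Star := star_part Phi m.
(** The index is the size of m |: F, so [Q k] is where the boundary of level k lands on removing m;
    the faces of size k to which m can be added form [Q k.+1]. *)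
Let Q (k : nat) : {set {set E}} :=
  [set F in Phi | [&& m \notin F, m |: F \in Phi & #|F|.+1 == k]].

Let bDel : in_boundary V Del.
Proof.
by move=> F v; rewrite !inE => /andP[FP _] vF /andP[FvP _]; apply: bP FvP.
Qed.

Let bStar : in_boundary V Star.
Proof.
by move=> F v; rewrite !inE => /andP[FP _] vF /andP[FvP _]; apply: bP FvP.
Qed.

(** The three terms are the removals of v from faces without m, of v other than m from faces with m,
    and of m itself. *)
Lemma full_boundary_min k :
  full_boundary Phi k
  = full_boundary Del k + full_boundary Star k + proj (Q k) *m ann m.
Proof.
rewrite (full_boundary_restrict R _ bP) (full_boundary_restrict R _ bDel).
rewrite (full_boundary_restrict R _ bStar) !proj_bdE.
rewrite [LHS](bigD1 m) // [\sum_(v in V) proj Del *m _ *m _](bigD1 m) //.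
rewrite [\sum_(v in V) proj Star *m _ *m _](bigD1 m) //= !proj_annE.
rewrite [mono _ (fun F => [&& F \in faces Del k, _ & _]%:R * _)]mono_eq0; last first.
  by move=> F; rewrite !inE; case: (m \in F); rewrite ?(andbF, mul0r).
rewrite [mono _ (fun F => [&& F \in faces Star k, _ & _]%:R * _)]mono_eq0; last first.
  by move=> F; rewrite !inE eqxx /= !andbF mul0r.
rewrite !add0r addrC -big_split /=; congr (_ + _).
  apply: eq_bigr => v /andP[_ vm]; rewrite !proj_annE mono_add.
  apply: eq_mono => F //; rewrite !inE [m == v]eq_sym vm /=.
  by case: (m \in F); rewrite ?andbF ?andbT ?mul0r ?addr0 ?add0r.
rewrite mono_mul; apply: eq_mono => F //=; rewrite !inE eqxx /=.
have [mF|mF] := boolP (m \in F); last by rewrite !(andbF, mul0r, mulr0).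
rewrite setD1K // mul1r [#|F|](cardsD1 m) mF /=.
by rewrite andbC andbA.
Qed.

(** This is [eigmult_cone] with A the boundary of the deletion, C that of the star part, and Z the
    addition of m on Q. There P A = A is [min_cover], C Z Z^T = C is [min_link], and C Z A = 0 is
    [bd_cre_bd] fed by [min_between]. *)
Lemma eigmult_full_boundary_min a k :
  ((a - 1 == 0)%R * #|{: {set E}}|
     + eigmult a ((full_boundary Phi k)^T *m full_boundary Phi k)
     + eigmult a (1%:M - proj (Q k))
   = (a == 0)%R * #|{: {set E}}|
     + eigmult (a - 1) ((full_boundary Star k)^T *m full_boundary Star k)
     + eigmult (a - 1) (full_boundary Del k *m (full_boundary Del k)^T))%N.
Proof.
have disj (S S' : {set {set E}}) : (forall F, F \in S -> m \notin F) ->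
    (forall F, F \in S' -> m \in F) -> S :&: S' = set0.
  move=> Sm S'm; apply/setP => F; rewrite !inE.
  by apply/negbTE/negP => /andP[/Sm/negP mF /S'm].
apply: (eigmult_cone (Z := cre m *m proj (Q k))).
- exact: proj_idem.
- exact: trmx_proj.
- rewrite (full_boundary_restrict R _ bDel) proj_bdE mulmx_sumr.
  apply: eq_bigr => v vV.
  rewrite proj_annE mono_mul; apply: eq_mono => F //=.
  case: and3P => [[]|]; rewrite ?(mul0r, mulr0) // !inE.
  move=> /andP[/andP[FP mF] /eqP Fk] vF /andP[FvP mFv]; rewrite FvP mFv.
  by rewrite (min_cover mV minV shP) //= -Fk (cardsD1 v F) vF eqxx !mul1r.
- rewrite /full_boundary !mulmxA proj_projE (_ : _ :&: _ = set0).
    by rewrite [proj set0]mono_eq0 ?mul0mx // => F; rewrite inE.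
  by apply: disj => F; rewrite !inE; [case/and4P|case/andP].
- rewrite /full_boundary -!mulmxA (_ : proj _ *m (cre m *m _) = 0) ?mulmx0 //.
  rewrite !mono_mul mono_eq0 // => F.
  by rewrite !inE eqxx !(andbF, mul0r).
- rewrite trmx_mul trmx_proj -[cre m]trmx_ann trmxK trmx_ann !mono_mul.
  apply: eq_mono => F.
    rewrite /= !inE eqxx sgnU1_id mul1r; case: (boolP (m \in F)) => mF.
      by rewrite !(andbF, mul0r, mulr0).
    rewrite setU1K //=; case: [&& _, _ & _]; rewrite ?(mul0r, mulr0) //.
    by rewrite !mul1r mulr1 sgn_sq.
  move=> /=; rewrite !inE; case: (boolP (m \in F)) => mF; last by rewrite setU1K.
  by rewrite !(andbF, mul0r, mulr0) eqxx.
- by rewrite -mulmxA proj_idem.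
- rewrite trmx_mul trmx_proj -[cre m]trmx_ann trmxK trmx_ann.
  rewrite (full_boundary_restrict R _ bStar) proj_bdE !mulmx_suml.
  apply: eq_bigr => v vV.
  rewrite proj_annE !mono_mul; apply: eq_mono => F /=; last first.
    case: (boolP (m \in F)) => mF; first by rewrite setD1K.
    by rewrite !(mul0r, mulr0) eqxx.
  have [mF|mF] := boolP (m \in F); last first.
    by rewrite !inE (negbTE mF) !(andbF, mul0r, mulr0).
  rewrite setD1K // !mul1r !inE eqxx mF /=.
  have [/and3P[/andP[FP /eqP Fk] vF FvP]|_] := boolP [&& _, v \in F & _];
    last by rewrite !mul0r.
  have vm : v != m by apply: contraTneq FvP => ->; rewrite eqxx andbF.
  have FmP : F :\ m \in Phi.
    by apply: (min_link mV minV shP _ mF vF vm); case/andP: FvP; case/andP: FP.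
  case/andP: FP => FP _.
  have -> : sgn m F = sgn m (F :\ m) by rewrite -{1}(setD1K mF) sgnU1_id.
  rewrite setD1K // FmP FP -Fk (cardsD1 m F) mF eqxx !(mul1r, mulr1).
  by rewrite -mulrA sgn_sq mulr1.
- rewrite (full_boundary_restrict R _ bStar) (full_boundary_restrict R _ bDel).
  rewrite !mulmxA.
  rewrite -(mulmxA _ (proj (Q k)) (proj Del)) proj_projE.
  have := @bd_cre_bd R E V m Star (faces Star k) (Q k :&: Del) (faces Del k) mV.
  rewrite !mulmxA; apply.
  + by move=> F; rewrite inE => /andP[].
  + by move=> F; rewrite !inE => /andP[/andP[]].
  move=> F u v uV vV; rewrite !inE => /andP[/andP[FP mF] /eqP Fk] vF.
  move=> /orP[/eqP->|/andP[uv uF]] um; first by rewrite eqxx in um.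
  have -> : (m |: F :\ v) :\ u = m |: (F :\ v :\ u).
    apply/setP => w; rewrite !inE; case: (eqVneq w m) => // ->.
    by rewrite eq_sym um.
  move=> /andP[GP _].
  have /andP[FvP mFvP] : (F :\ v \in Phi) && (m |: F :\ v \in Phi).
    by apply: (min_between mV minV shP uV vV FP mF vF _ GP); rewrite !inE uv.
  have mFv : m \notin F :\ v by rewrite !inE negb_and mF orbT.
  rewrite FvP mFvP eqxx (negbTE mF) !andbF cardsU1 mFv add1n.
  by rewrite -Fk (cardsD1 v F) vF add1n eqxx.
- by rewrite full_boundary_min trmx_mul trmx_proj -[cre m]trmx_ann trmxK.
Qed.

Lemma card_deletion_star (Psi : {set {set E}}) k :
  #|faces Psi k|
  = (#|faces (deletion Psi m) k| + #|faces (star_part Psi m) k|)%N.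
Proof.
rewrite -(cardsID [set F : {set E} | m \in F]) addnC.
congr (_ + _)%N; apply: eq_card => F; rewrite !inE 1?andbAC //.
by rewrite [LHS]andbC -andbAC.
Qed.

(** A face outside the reduction either admits m and lies in [Q k.+1], or contains m and is m |: F
    for a unique F in [Q k]. *)
Lemma card_faces_min k :
  (#|faces Del k| + #|faces Star k|
   = #|Q k| + #|Q k.+1| + #|faces (reduction Phi m) k|)%N.
Proof.
rewrite -(cardsID (reduction Phi m) (faces Del k)).
rewrite -(cardsID (reduction Phi m) (faces Star k)).
have -> : faces Del k :\: reduction Phi m = Q k.+1.
  apply/setP => F; rewrite in_setD in_reduction !inE eqSS.
  case: (F \in Phi); rewrite ?andbF //=.
  by case: (m \in F) => /=; rewrite ?andbF ?negbK.
have -> : #|faces Star k :\: reduction Phi m| = #|Q k|.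
  rewrite -(card_in_imset (f := fun F => m |: F) (D := Q k)); last first.
    move=> F G; rewrite !inE => /and4P[_ mF _ _] /and4P[_ mG _ _] FG.
    by rewrite -(setU1K mF) FG setU1K.
  apply: eq_card => F; apply/idP/imsetP => [|[G]].
    rewrite in_setD in_reduction !inE => /andP[+ /andP[/andP[FP mF] /eqP Fk]].
    rewrite FP mF negbK => FmP; exists (F :\ m); last by rewrite setD1K.
    by rewrite !inE eqxx FmP setD1K // FP -Fk (cardsD1 m F) mF add1n eqxx.
  rewrite [G \in _]inE => /and4P[GP mG mGP /eqP Gk] ->.
  rewrite in_setD in_reduction !inE eqxx mGP /= setU1K // GP /=.
  by rewrite cardsU1 mG add1n Gk eqxx.
have -> : (#|faces (reduction Phi m) k|
    = #|faces Del k :&: reduction Phi m| + #|faces Star k :&: reduction Phi m|)%N.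
  rewrite card_deletion_star; congr (_ + _)%N; apply: eq_card => F.
    rewrite in_setI ![F \in faces _ _]inE ![F \in deletion _ _]inE in_reduction.
    by case: (F \in Phi); case: (m \in F); case: (_ == k); rewrite ?(andbT, andbF).
  rewrite in_setI ![F \in faces _ _]inE ![F \in star_part _ _]inE in_reduction.
  by case: (F \in Phi); case: (m \in F); case: (_ == k); rewrite ?(andbT, andbF).
lia.
Qed.

Lemma eigmult_complement a k :
  (eigmult a (1%:M - proj (Q k)) + (a == 0)%R * (#|{: {set E}}| - #|Q k|)
   = (a == 0)%R * #|{: {set E}}| + (a - 1 == 0)%R * (#|{: {set E}}| - #|Q k|))%N.
Proof.
have -> : 1%:M - proj (Q k) = proj (~: Q k).
  rewrite -proj_setT; apply/eqP; rewrite subr_eq mono_add; apply/eqP.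
  by apply: eq_mono => F //; rewrite !inE; case: (_ && _); rewrite ?addr0 ?add0r.
have -> : (#|{: {set E}}| - #|Q k| = #|~: Q k|)%N by rewrite [RHS]cardsCs setCK.
exact: eigmult_proj.
Qed.

Let shDel : shifted_on (V :\ m) Del := shifted_on_deletion m shP.
Let shStar : shifted_on (V :\ m) Star := shifted_on_star m shP.

(** [eigmult_full_boundary_min] at levels k and k.+1 gives the two halves of the three Laplacians; B
    B^T and B^T B count alike, the matrices being square. The sizes of [Q k] and [Q k.+1] that
    remain are turned into the size of the reduction by [card_faces_min]. *)
Lemma count_spectrum_min a k :
  (count_mem a (spectrum R Phi k) + (a - 1 == 0)%R * #|faces (reduction Phi m) k|
   = count_mem (a - 1)%R (spectrum R Del k) + count_mem (a - 1)%R (spectrum R Star k)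
     + (a == 0)%R * #|faces (reduction Phi m) k|)%N.
Proof.
rewrite !count_spectrum.
have := eigmult_full_laplacian a Phi k; have := eigmult_full_laplacian (a - 1) Del k.
have := eigmult_full_laplacian (a - 1) Star k.
have := eigmult_full_laplacian_split a k shP.
have := eigmult_full_laplacian_split (a - 1) k shDel.
have := eigmult_full_laplacian_split (a - 1) k shStar.
have := eigmult_full_boundary_min a k; have := eigmult_full_boundary_min a k.+1.
have := eigmult_complement a k; have := eigmult_complement a k.+1.
rewrite !(eigmult_mulmxC_sq _ (full_boundary _ _) (_^T)).
have := card_faces_min k; have := card_deletion_star Phi k.
have q1 : (#|Q k| <= #|{: {set E}}|)%N by apply: max_card.
have q2 : (#|Q k.+1| <= #|{: {set E}}|)%N by apply: max_card.
rewrite -/Del -/Star.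
move: q1 q2.
do ![move: (eigmult _ (laplacian _ _ _))].
do ![move: (eigmult _ (full_laplacian _ _ _))].
do ![move: (eigmult _ (_^T *m _))]; do ![move: (eigmult _ (1%:M - _))].
do ![move: #|faces _ _|]; do ![move: #|Q _|].
move: #|_| (a == 0)%R (a - 1 == 0)%R.
do 2!case; rewrite ?(mul1n, mul0n); lia.
Qed.

End Minimum.

(** * Counting the faces of an iterated reduction *)

Section Count.
Variable E : {fset int}.
Implicit Types (u v e m : E) (F G H : {set E}) (V : {set E}) (D Phi Psi : {set {set E}}).

(** Twice the number of faces is the sum over F of the indicators of F and of its image under the
    transposition of u and v; the hypothesis equates these sums term by term. *)
Lemma eq_card_faces_swap u v Psi1 Psi2 k :
    (forall H, u \notin H -> v \notin H ->
      [/\ (H \in Psi1) = (H \in Psi2),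
          ((u |: H \in Psi1) + (v |: H \in Psi1)
           = (u |: H \in Psi2) + (v |: H \in Psi2))%N
        & (u |: (v |: H) \in Psi1) = (u |: (v |: H) \in Psi2)]) ->
  #|faces Psi1 k| = #|faces Psi2 k|.
Proof.
move=> sq.
pose sw F := [set tperm u v x | x in F].
have swK : involutive sw.
  move=> F; rewrite /sw -imset_comp -[RHS]imset_id; apply: eq_imset => x /=.
  exact: tpermK.
have sw_card F : #|sw F| = #|F| by apply: card_imset; apply: perm_inj.
have sum_faces Psi : (2 * #|faces Psi k|
    = \sum_(F : {set E} | #|F| == k) ((F \in Psi) + (sw F \in Psi)))%N.
  have one : #|faces Psi k| = (\sum_(F : {set E} | #|F| == k) (F \in Psi))%N.
    rewrite -sum1_card big_mkcond /= [RHS]big_mkcond /=; apply: eq_bigr => F _.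
    by rewrite inE; case: (F \in Psi); case: (_ == k).
  rewrite mul2n -addnn big_split /= -one; congr (_ + _)%N; rewrite one.
  by rewrite (reindex_inj (inv_inj swK)) /=; apply: eq_bigl => F; rewrite sw_card.
apply/eqP; rewrite -(eqn_pmul2l (isT : 0 < 2)%N) !sum_faces; apply/eqP.
apply: eq_bigr => F _.
have swH H : u \notin H -> v \notin H -> sw H = H.
  move=> uH vH; rewrite -[RHS]imset_id; apply: eq_in_imset => x xH.
  by rewrite tpermD //; apply: contraTneq xH => <-.
have swU x H : sw (x |: H) = tperm u v x |: sw H by rewrite /sw imsetU1.
have [uF|uF] := boolP (u \in F); have [vF|vF] := boolP (v \in F).
- have [uv|uv] := eqVneq u v.
    have [] := sq (F :\ u); rewrite ?inE -?uv ?eqxx // !setD1K // => _ + _.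
    suff -> : sw F = F by [].
    rewrite /sw -uv -[RHS]imset_id; apply: eq_imset => x.
    by rewrite tperm1 perm1.
  have FE : F = u |: (v |: F :\ u :\ v).
    by rewrite setD1K ?setD1K // !inE eq_sym uv.
  have [] := sq (F :\ u :\ v); rewrite ?inE ?eqxx ?andbF // -FE => _ _ e.
  have -> : sw F = F.
    by rewrite {1}FE !swU tpermL tpermR swH ?inE ?eqxx ?andbF // setUCA -FE.
  by rewrite e.
- have [] := sq (F :\ u); rewrite ?inE ?eqxx ?(negbTE vF) ?andbF //.
  rewrite setD1K // -[in sw F](setD1K uF) swU tpermL swH //.
    by rewrite setD11.
  by rewrite inE (negbTE vF) andbF.
- have [] := sq (F :\ v); rewrite ?inE ?eqxx ?(negbTE uF) ?andbF //.
  rewrite setD1K // -[in sw F](setD1K vF) swU tpermR swH ?setD11 //.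
    by move=> _ e _; rewrite addnC e addnC.
  by rewrite inE (negbTE uF) andbF.
- by have [] := sq F uF vF; rewrite swH // => ->.
Qed.

(* On each square [H, m H, e H, m e H] a family shifted on [V] is an interval of the
   chain [H < m H < e H < m e H], which leaves finitely many cases. *)
Lemma card_reduction2 V m e Phi k :
    m \in V -> e \in V -> (val m < val e)%R -> shifted_on V Phi ->
  #|faces (reduction Phi m) k| = #|faces (reduction (reduction Phi e) m) k|.
Proof.
move=> mV eV me [_ [D [D' [[cD xD] [cD' xD'] PE]]]].
have mNe : m != e by apply: contraTneq me => ->; rewrite ltxx.
apply: (eq_card_faces_swap (u := m) (v := e)) => H mH eH.
have mem (X : {set {set E}}) : (forall v F, v \in V -> F \in X -> F :\ v \in X) ->
   (forall u v F, u \in V -> v \in V -> (val u < val v)%R ->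
     v \in F -> u \notin F -> F \in X -> u |: F :\ v \in X) ->
   [/\ m |: (e |: H) \in X -> e |: H \in X, e |: H \in X -> m |: H \in X
     & m |: H \in X -> H \in X].
  move=> cX xX; split=> XH.
  - by have := cX m _ mV XH; rewrite setU1K // !inE negb_or mNe.
  - have := xX m e _ mV eV me _ _ XH; rewrite setU1K //; apply; rewrite !inE ?eqxx //.
    by rewrite negb_or mNe.
  - by have := cX m _ mV XH; rewrite setU1K.
have [D1 D2 D3] := mem D cD xD; have [D'1 D'2 D'3] := mem D' cD' xD'.
have emH : e |: (m |: H) = m |: (e |: H) by rewrite setUCA.
have K1 : (m |: H) :\ m = H by rewrite setU1K.
have K2 : (e |: H) :\ e = H by rewrite setU1K.
have K3 : (m |: (e |: H)) :\ m = e |: H by rewrite setU1K // !inE negb_or mNe.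
have K4 : (m |: (e |: H)) :\ e = m |: H.
  by rewrite -emH setU1K // !inE negb_or eq_sym mNe.
have M1 : (m \in e |: H) = false by rewrite !inE (negbTE mNe) (negbTE mH).
have M2 : (e \in m |: H) = false.
  by rewrite !inE eq_sym (negbTE mNe) (negbTE eH).
have M3 : e \in m |: (e |: H) by rewrite !inE eqxx orbT.
rewrite !in_reduction.
rewrite !(setU11, negbTE mH, negbTE eH, K1, K2, K3, K4, M1, M2, M3, emH).
rewrite PE !in_setD.
move: D1 D2 D3 D'1 D'2 D'3.
(* The eight memberships are those of the four corners of the square in D and in D'. *)
do 8![case: (_ \in _) => /=] => D1 D2 D3 D4 D5 D6; try by split.
all: try by [have := D1 isT | have := D2 isT | have := D3 isT].
all: by [have := D4 isT | have := D5 isT | have := D6 isT].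
Qed.

End Count.

Lemma eigmult_le (F : fieldType) n (M : 'M[F]_n) a : (eigmult a M <= n)%N.
Proof.
have := mup_geq a (eigmult a M) (char_poly_neq0 M); rewrite leqnn => /esym.
move=> /dvdp_leq - /(_ (char_poly_neq0 M)).
by rewrite size_exp_XsubC size_char_poly.
Qed.

(** * Spectra of free families, contractions and the least vertex *)

Section Spectra.
Variables (R : realType) (E : {fset int}).
Implicit Types (u v e m : E) (F G H : {set E}) (V : {set E}) (Phi Psi : {set {set E}}).
Local Notation proj := (@proj R {set E}).
Local Notation ann := (@ann R E).
Local Notation cre := (@cre R E).
Local Notation sgn := (@sgn R E).
Local Notation full_boundary := (@full_boundary R E).

Lemma spectrum_nil Phi k : faces Phi k = set0 -> spectrum R Phi k = [::].
Proof.
move=> Phi0; have : forall a, a \notin spectrum R Phi k.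
  move=> a; rewrite -has_pred1 has_count count_spectrum -leqNgt.
  by apply: leq_trans (eigmult_le _ _) _; rewrite Phi0 cards0.
by case: spectrum => // a s /(_ a); rewrite inE eqxx.
Qed.

Lemma count_spectrum_free a Psi k :
  (forall F v, F \in Psi -> v \in F -> F :\ v \notin Psi) ->
  count_mem a (spectrum R Psi k) = ((a == 0)%R * #|faces Psi k|)%N.
Proof.
move=> free; have boundary0 j : full_boundary Psi j = 0.
  rewrite /full_boundary proj_bdE big1 // => v _; rewrite proj_annE mono_eq0 // => F.
  by case: and3P => [[]|]; rewrite ?mul0r // inE => /andP[/free FP _] /FP/negbTE->.
rewrite count_spectrum; have := eigmult_full_laplacian a Psi k.
by rewrite /full_laplacian !boundary0 trmx0 !mul0mx addr0 eigmult0 addnC => /addnI->.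
Qed.

Lemma in_contraction Phi e F :
  (F \in contraction Phi e) = (e \notin F) && (e |: F \in Phi).
Proof.
apply/imsetP/andP => [[G]|[eF eFP]].
  by rewrite inE => /andP[GP eG] ->; rewrite !inE eqxx setD1K.
exists (e |: F); rewrite ?setU1K //.
by rewrite inE eFP setU11.
Qed.

(** The minus sign comes from exchanging the removals of e and v; it disappears from the Laplacians,
    which are quadratic in the boundaries. *)
Lemma full_boundary_contraction Phi e k :
  full_boundary (star_part Phi e) k.+1
  = - (cre e *m full_boundary (contraction Phi e) k *m ann e).
Proof.
rewrite /full_boundary !proj_bdE mulmx_sumr mulmx_suml -sumrN.
apply: eq_bigr => v _; rewrite !proj_annE !mono_mul.
apply/eqP; rewrite -addr_eq0; apply/eqP.
rewrite [X in _ + X](@eq_mono _ _ _ _ (fun F => F :\ v)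
   (fun F => - ([&& F \in faces (star_part Phi e) k.+1, v \in F
     & F :\ v \in star_part Phi e]%:R * sgn v F))) => [|F|F] /=.
- by rewrite mono_add mono_eq0 // => F; rewrite subrr.
- rewrite ![_ \in faces _ _]inE !in_contraction ![_ \in star_part _ _]inE.
  have [eF|eF] := boolP (e \in F);
    last by rewrite !(andbF, andbT, mul0r, mulr0) oppr0.
  rewrite setD1K // [#|F|](cardsD1 e) eF add1n eqSS !inE eqxx !andbT /=.
  have [->|vNe] := eqVneq v e.
    by rewrite ?eqxx /= ?(andbF, mul0r, mulr0) oppr0.
  have ev : e != v by rewrite eq_sym.
  move=> /=.
  have -> : e |: F :\ e :\ v = F :\ v.
    by rewrite setD1C setD1K // !inE ev.
  rewrite eF andbT; case: and3P => [[FP vF FvP]|];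
    rewrite ?(mul0r, mulr0, oppr0, mul1r, mulr1) //.
  rewrite (sgnD1 R v eF) (sgnD1 R e vF).
  have -> : sgn e (F :\ v) = sgn e (F :\ e :\ v).
    rewrite -{1}(@setD1K _ e (F :\ v)) ?sgnU1_id ?inE ?ev //.
    by rewrite setD1C.
  (* A factor [sgn e] squared is inserted to match the removal and the return of e on the other
     side. *)
  rewrite (sign_lt_flip R ev) -[in RHS](mulr1 (sgn v _)).
  rewrite -(sgn_sq R e (F :\ e :\ v)).
  ring.
case: (boolP (e \in F)) => [eF|]; last by rewrite mul0r mulr0 eqxx.
case: (boolP (v == e)) => [/eqP->|vNe].
  by rewrite !setD11 andbF mul0r mulr0 mul0r eqxx.
by rewrite setD1C setD1K // !inE eq_sym vNe.
Qed.

(** The left Laplacian is cre L ann for L the right one. Cycling gives L N, where N projects on the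
    sets without e and is absorbed by L. *)
Lemma full_laplacian_contraction a Phi e k :
  eigmult a (full_laplacian R (star_part Phi e) k.+1)
  = eigmult a (full_laplacian R (contraction Phi e) k).
Proof.
pose N := ann e *m cre e; pose T := full_boundary (contraction Phi e).
have NN : N = proj [set F : {set E} | e \notin F].
  rewrite /N mono_mul; apply: eq_mono => F //=.
    rewrite !inE eqxx sgnU1_id mul1r; case: (e \in F); rewrite ?(mul0r, mulr0) //.
    by rewrite mul1r sgn_sq.
  rewrite !inE eqxx; case: (boolP (e \in F)) => eF.
    by rewrite mul0r mulr0 eqxx.
  by rewrite setU1K.
have sub (S : {set {set E}}) : S \subset contraction Phi e ->
    S :&: [set F : {set E} | e \notin F] = S.
  move=> /subsetP SC; apply/setIidPl/subsetP => F /SC.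
  by rewrite in_contraction inE => /andP[].
have tN j : T j *m N = T j.
  rewrite /T /full_boundary NN -mulmxA proj_projE sub //; apply/subsetP => F.
  by rewrite inE => /andP[].
have Nt j : N *m T j = T j.
  by rewrite /T /full_boundary NN !mulmxA proj_projE setIC sub.
have trN : N^T = N by rewrite NN trmx_proj.
have trc : (cre e)^T = ann e by rewrite -trmx_ann trmxK.
have trNt j : (T j)^T *m N = (T j)^T.
  by rewrite -{1}trN -trmx_mul Nt.
rewrite /full_laplacian !full_boundary_contraction -/T.
move: T tN trNt {Nt} => T tN trNt.
pose L := T k.+1 *m (T k.+1)^T + (T k)^T *m T k.
transitivity (eigmult a (cre e *m (L *m ann e))); first congr (eigmult a _).
  rewrite ![(- _)^T]linearN /= !(mulmxN, mulNmx) !opprK.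
  rewrite !trmx_mul trmx_ann trc mulmxDl mulmxDr !mulmxA.
  have absorb (M : 'M_#|{set E}|) :
      M *m N = M -> cre e *m M *m ann e *m cre e = cre e *m M.
    by move=> MN; rewrite -!mulmxA -/N MN.
  by rewrite !absorb ?tN ?trNt.
rewrite eigmult_mulmxC_sq -mulmxA; congr (eigmult a _).
by rewrite -/N mulmxDl -!mulmxA tN trNt.
Qed.

Lemma card_faces_contraction Phi e k :
  #|faces (star_part Phi e) k.+1| = #|faces (contraction Phi e) k|.
Proof.
rewrite -(card_in_imset (f := fun F => e |: F) (D := faces (contraction Phi e) k));
  last first.
  move=> F G; rewrite ![_ \in faces _ _]inE !in_contraction.
  move=> /andP[/andP[eF _] _] /andP[/andP[eG _] _] FG.
  by rewrite -(setU1K eF) FG setU1K.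
apply: eq_card => F; apply/idP/imsetP => [|[G]].
  rewrite !inE => /andP[/andP[FP eF] /eqP Fk].
  exists (F :\ e); rewrite ?setD1K // inE in_contraction setD11 setD1K // FP.
  by rewrite -eqSS -Fk (cardsD1 e F) eF add1n eqxx.
rewrite [G \in _]inE in_contraction => /andP[/andP[eG GP] /eqP Gk] ->.
by rewrite !inE GP eqxx /= cardsU1 eG Gk.
Qed.

Lemma perm_spectrum_contraction Phi e k :
  perm_eq (spectrum R (star_part Phi e) k.+1) (spectrum R (contraction Phi e) k).
Proof.
apply/allP => a _; rewrite /= !count_spectrum; apply/eqP.
have := eigmult_full_laplacian a (star_part Phi e) k.+1.
have := eigmult_full_laplacian a (contraction Phi e) k.
move: (eigmult _ (laplacian _ _ _)) (eigmult _ (laplacian _ _ _)) => x y.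
by rewrite full_laplacian_contraction card_faces_contraction => -> /addnI.
Qed.

Lemma perm_spectrum_free Psi k :
  (forall F v, F \in Psi -> v \in F -> F :\ v \notin Psi) ->
  perm_eq (spectrum R Psi k) (nseq #|faces Psi k| 0).
Proof.
move=> free; apply/allP => a _; rewrite /= count_spectrum_free // count_nseq /=.
by rewrite [a == 0]eq_sym.
Qed.

(** The eigenvalues 1 replaced by 0 are appended on the left, which avoids a difference of
    multisets. *)
Lemma perm_spectrum_min V m Phi k :
  m \in V -> (forall v, v \in V -> (val m <= val v)%R) -> shifted_on V Phi ->
  let r := #|faces (reduction Phi m) k| in
  perm_eq (spectrum R Phi k ++ nseq r 1)
    ([seq a + 1 | a <- spectrum R (deletion Phi m) k]
     ++ [seq a + 1 | a <- spectrum R (star_part Phi m) k] ++ nseq r 0).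
Proof.
move=> mV minV shP /=; apply/allP => a _.
rewrite /= !count_cat !count_map !count_nseq /=.
have shift s :
    count (preim (fun b : R => b + 1) (pred1 a)) s = count_mem (a - 1) s.
  by apply: eq_count => b /=; rewrite [RHS]eq_sym subr_eq eq_sym.
rewrite !shift; apply/eqP.
have := count_spectrum_min mV minV shP a k.
by rewrite subr_eq0 [1 == a]eq_sym [0 == a]eq_sym addnA.
Qed.

End Spectra.

(** * The spectrum polynomial *)

Lemma tqM (R : realType) i j (a b : R) : 0 <= a -> 0 <= b ->
  tq i a * tq j b = tq (i + j)%N (a + b).
Proof.
move=> a0 b0; rewrite /tq malgM_def fgmulUU mulr1; congr << 1 *g _ >>.
by apply: val_inj; rewrite /= !val_insubd /= a0 b0 addr_ge0.
Qed.

Lemma sum_perm_shift (R : nzRingType) (M : zmodType) (f : R -> M) s s1 s2 r :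
  perm_eq (s ++ nseq r 1)
    ([seq a + 1 | a <- s1] ++ [seq a + 1 | a <- s2] ++ nseq r 0) ->
  \sum_(a <- s) f a + f 1 *+ r
  = \sum_(a <- s1) f (a + 1) + (\sum_(a <- s2) f (a + 1) + f 0 *+ r).
Proof.
move=> /(perm_big _) p; have := p M +%R 0 xpredT f.
by rewrite !big_cat /= !big_map !big_nseq !iter_addr_0.
Qed.

(** Here s, sm, sm', se, se', re stand for Phi, its deletion and star part at m, those at e, and Phi
    || e. The y's are the four double slices, w1 and w2 the slices at m of Phi || e, and rm, rm' the
    slices at e of Phi || m. *)
Lemma recursion_combine (A : comNzRingType)
    (q s sm sm' se se' re rm rm' y1 y2 y3 y4 w1 w2 : A) :
  s = q * sm + q * sm' + (1 - q) * (rm + rm') ->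
  sm = q * y1 + q * y2 + (1 - q) * w1 ->
  sm' = q * y3 + q * y4 + (1 - q) * w2 ->
  se = q * y1 + q * y3 + (1 - q) * rm ->
  se' = q * y2 + q * y4 + (1 - q) * rm' ->
  re = q * w1 + q * w2 + (1 - q) * (rm + rm') ->
  s = q * se + q * se' + (1 - q) * re.
Proof. by move=> -> -> -> -> -> ->; ring. Qed.

Section Polynomial.
Variables (R : realType) (E : {fset int}).
Implicit Types (u v e m : E) (F G H : {set E}) (V : {set E}) (Phi Psi : {set {set E}}).

Local Notation S := (spectrum_poly R).
Local Notation q := (tq 0 (1 : R)).
Local Notation t := (tq 1 (0 : R)).

Definition spectrum_level Phi k := \sum_(a <- spectrum R Phi k) tq k a.

Lemma spectrum_polyE Phi : S Phi = \sum_(i < #|{: E}|.+1) spectrum_level Phi i.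
Proof. by []. Qed.

Lemma spectrum_level_free Psi k :
  (forall F v, F \in Psi -> v \in F -> F :\ v \notin Psi) ->
  spectrum_level Psi k = tq k 0 *+ #|faces Psi k|.
Proof.
move=> free; rewrite /spectrum_level (perm_big _ (perm_spectrum_free R k free)) /=.
by rewrite big_nseq iter_addr_0.
Qed.

Lemma spectrum_level_shift Psi k :
  \sum_(a <- spectrum R Psi k) tq k (a + 1) = q * spectrum_level Psi k.
Proof.
rewrite mulr_sumr big_seq [RHS]big_seq; apply: eq_bigr => a /spectrum_ge0 a0.
by rewrite (tqM _ _ ler01 a0) add0n [1 + a]addrC.
Qed.

Lemma spectrum_level_min V m Phi k :
  m \in V -> (forall v, v \in V -> (val m <= val v)%R) -> shifted_on V Phi ->
  spectrum_level Phi k =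
    q * spectrum_level (deletion Phi m) k + q * spectrum_level (star_part Phi m) k
    + (1 - q) * spectrum_level (reduction Phi m) k.
Proof.
move=> mV minV shP.
have := sum_perm_shift (tq k) (perm_spectrum_min R k mV minV shP).
rewrite -/(spectrum_level Phi k).
have -> : tq k (1 : R) = q * tq k 0 by rewrite (tqM _ _ ler01 (lexx 0)) addr0 add0n.
rewrite 2!spectrum_level_shift.
rewrite (spectrum_level_free _ (reduction_min_free mV minV shP)).
move: q (tq k 0 : {malg int[tqmonom R]}) => c f.
do 3!move: (spectrum_level _ _); move=> x y z /(canRL (addrK _)) ->.
by rewrite -mulrnAr mulrBl mul1r !addrA.
Qed.

(** Multiplication by t raises each level by one; the unmatched end levels vanish, as no star face
    is empty and no face of the contraction is all of E. *)
Lemma spectrum_poly_contraction Phi e :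
  t * S (contraction Phi e) = S (star_part Phi e).
Proof.
have lvlS k :
    t * spectrum_level (contraction Phi e) k = spectrum_level (star_part Phi e) k.+1.
  rewrite /spectrum_level [RHS](perm_big _ (perm_spectrum_contraction R Phi e k)) /=.
  rewrite mulr_sumr big_seq [RHS]big_seq; apply: eq_bigr => a /spectrum_ge0 a0.
  by rewrite (tqM _ _ (lexx 0) a0) add1n add0r.
have lvl_star0 : spectrum_level (star_part Phi e) 0 = 0.
  rewrite /spectrum_level spectrum_nil ?big_nil //.
  apply/setP => F; rewrite !inE; apply/negP => /andP[/andP[_ eF]].
  by rewrite cards_eq0 => /eqP F0; rewrite F0 inE in eF.
have lvl_top : spectrum_level (contraction Phi e) #|{: E}| = 0.
  rewrite /spectrum_level spectrum_nil ?big_nil //.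
  apply/setP => F; rewrite inE in_contraction inE.
  apply/negP => /andP[/andP[eF _] /eqP FE].
  have FT : F = setT by apply/eqP; rewrite eqEcard subsetT cardsT FE leqnn.
  by rewrite FT inE in eF.
rewrite !spectrum_polyE big_ord_recr big_ord_recl /= mulrDr mulr_sumr.
rewrite lvl_star0 lvl_top mulr0 addr0 add0r; apply: eq_bigr => i _.
exact: lvlS.
Qed.

(** Using the star part instead of the contraction keeps face sizes and absorbs the factor t. *)
Definition recursion_at Phi e :=
  S Phi = q * S (deletion Phi e) + q * S (star_part Phi e)
          + (1 - q) * S (reduction Phi e).

Lemma recursion_min V m Phi :
  m \in V -> (forall v, v \in V -> (val m <= val v)%R) -> shifted_on V Phi ->
  recursion_at Phi m.
Proof.
move=> mV minV shP; rewrite /recursion_at !spectrum_polyE !mulr_sumr -!big_split /=.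
by apply: eq_bigr => i _; apply: (@spectrum_level_min V).
Qed.

Lemma spectrum_poly_free Psi :
  (forall F v, F \in Psi -> v \in F -> F :\ v \notin Psi) ->
  S Psi = \sum_(i < #|{: E}|.+1) tq i 0 *+ #|faces Psi i|.
Proof. by move=> free; apply: eq_bigr => i _; apply: spectrum_level_free. Qed.

Lemma recursion_shifted_on V Phi e :
  shifted_on V Phi -> e \in V -> recursion_at Phi e.
Proof.
have [n] := ubnP #|V|; elim: n V Phi e => // n IHn V Phi e Vn shP eV.
pose m := [arg min_(v < e in V) val v]%O.
have [mV minV] : m \in V /\ forall v, v \in V -> (val m <= val v)%R.
  by rewrite /m; case: arg_minP => //; split.
have [->|em] := eqVneq e m; first exact: recursion_min minV shP.
have me : m != e by rewrite eq_sym.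
have mVe : m \in V :\ e by rewrite !inE me.
have eVm : e \in V :\ m by rewrite !inE em.
have minVe v : v \in V :\ e -> (val m <= val v)%R.
  by rewrite inE => /andP[_ /minV].
have lt_me : (val m < val e)%R by rewrite lt_neqAle minV // (inj_eq val_inj) me.
have Vmn : (#|V :\ m| < n)%N by move: Vn; rewrite (cardsD1 m V) mV.
have e0 := recursion_min mV minV shP.
have e1 := IHn _ _ e Vmn (shifted_on_deletion m shP) eVm.
have e2 := IHn _ _ e Vmn (shifted_on_star m shP) eVm.
have e3 := recursion_min mVe minVe (shifted_on_deletion e shP).
have e4 := recursion_min mVe minVe (shifted_on_star e shP).
have shR := shifted_on_reduction eV shP.
have e5 := recursion_min mVe minVe shR.
have free1 := reduction_min_free mV minV shP.
have free2 := reduction_min_free mVe minVe shR.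
have c1 : deletion (deletion Phi m) e = deletion (deletion Phi e) m.
  by apply/setP => F; rewrite !inE andbAC.
have c2 : star_part (deletion Phi m) e = deletion (star_part Phi e) m.
  by apply/setP => F; rewrite !inE andbAC.
have c3 : deletion (star_part Phi m) e = star_part (deletion Phi e) m.
  by apply/setP => F; rewrite !inE andbAC.
have c4 : star_part (star_part Phi m) e = star_part (star_part Phi e) m.
  by apply/setP => F; rewrite !inE andbAC.
(* Toggling y does not affect the membership of x, so reducing at one vertex commutes with slicing
   at another. *)
have mem x y F : x != y ->
    (x \in (if y \in F then F :\ y else y |: F)) = (x \in F).
  by move=> /negbTE xy; case: ifP; rewrite !inE xy.
have c5 x y : x != y ->
    deletion (reduction Phi x) y = reduction (deletion Phi y) x.
  move=> xy; apply/setP => F; rewrite inE !in_reduction ![_ \in deletion _ _]inE.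
  rewrite mem 1?eq_sym //.
  by case: (F \in Phi); case: (y \in F); rewrite ?(andbF, andbT).
have c6 x y : x != y ->
    star_part (reduction Phi x) y = reduction (star_part Phi y) x.
  move=> xy; apply/setP => F; rewrite inE !in_reduction ![_ \in star_part _ _]inE.
  rewrite mem 1?eq_sym //.
  by case: (F \in Phi); case: (y \in F); rewrite ?(andbF, andbT).
(* Both families are free, so their spectra consist of zeros and only the face numbers matter. *)
have r1 : S (reduction (reduction Phi e) m) = S (reduction Phi m).
  rewrite !spectrum_poly_free //; apply: eq_bigr => i _.
  by rewrite -(card_reduction2 _ mV eV lt_me shP).
have sub_free (p : pred {set E}) F v :
    F \in [set F in reduction Phi m | p F] -> v \in F ->
    F :\ v \notin [set F in reduction Phi m | p F].
  rewrite [F \in _]inE [_ :\ _ \in _]inE negb_and.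
  by move=> /andP[/free1 FR _] /FR->.
have r2 : S (reduction Phi m)
    = S (reduction (deletion Phi e) m) + S (reduction (star_part Phi e) m).
  rewrite -c5 // -c6 // !spectrum_poly_free //.
  - rewrite -big_split /=; apply: eq_bigr => i _.
    by rewrite (card_deletion_star e) mulrnDr.
  - exact: sub_free.
  - exact: sub_free.
move: e0 e1 e2 e3 e4 e5; rewrite /recursion_at.
rewrite c1 c2 c3 c4 (c5 _ _ em) (c6 _ _ em) r1 r2.
exact: recursion_combine.
Qed.

End Polynomial.

(** * The componentwise order *)

Section SortCons.
Variables (d : Order.disp_t) (T : orderType d).
Implicit Types (x y : T) (s : seq T).
Local Open Scope order_scope.

Lemma sort_cons x s : sort <=%O (x :: s) = merge <=%O [:: x] (sort <=%O s).
Proof.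
apply: le_sorted_eq; first exact: sort_le_sorted.
  by apply: merge_sorted; [exact: le_total | | exact: sort_le_sorted].
by rewrite perm_sym perm_merge perm_sym perm_sort /= perm_cons perm_sym perm_sort.
Qed.

(** By induction on s; when x lands before the head z and y after it, the tails compare the
    insertions of z and of y, and inserting z puts it back in front. *)
Lemma all2_le_merge1 x y s : x <= y -> sorted <=%O s ->
  all2 <=%O (merge <=%O [:: x] s) (merge <=%O [:: y] s).
Proof.
elim: s x y => [|z s IHs] x y xy /= zs; first by rewrite xy.
have all2_refl s' : all2 <=%O s' s' by elim: s' => //= w s' ->; rewrite lexx.
have ss := path_sorted zs.
have [xz|zx] := leP x z; have [yz|zy] := leP y z => /=.
- by rewrite xy lexx all2_refl.
- have := IHs z y (ltW zy) ss; suff -> : merge <=%O [:: z] s = z :: s by rewrite /= xz.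
  by case: (s) zs => //= w s' /andP[->].
- by have := lt_le_trans zx (le_trans xy yz); rewrite ltxx.
- by rewrite lexx; apply: IHs.
Qed.

Lemma all2_le_sort_cons x y s : x <= y ->
  all2 <=%O (sort <=%O (x :: s)) (sort <=%O (y :: s)).
Proof. by move=> xy; rewrite !sort_cons all2_le_merge1 // sort_le_sorted. Qed.

End SortCons.

Lemma increasing_listingU1 (E : {fset int}) (u : E) (F : {set E}) : u \notin F ->
  increasing_listing (u |: F) = sort <=%O (val u :: [seq val x | x <- enum F]).
Proof.
move=> uF; rewrite /increasing_listing -/(map val (u :: enum F)).
apply/perm_sort_leP/perm_map/uniq_perm; rewrite /= ?enum_uniq ?mem_enum ?uF //.
by move=> x; rewrite !inE !mem_enum !inE.
Qed.

(** Both sets arise from F minus v by inserting one vertex, u or v. *)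
Lemma le_C_exchange (E : {fset int}) (u v : E) (F : {set E}) :
  (val u < val v)%R -> v \in F -> u \notin F -> le_C (u |: F :\ v) F.
Proof.
move=> uv vF uF; rewrite /le_C -{2}(setD1K vF) !increasing_listingU1 ?setD11 //.
  exact/all2_le_sort_cons/ltW.
by rewrite inE negb_and uF orbT.
Qed.

Lemma shifted_on_setT (E : {fset int}) (Phi : {set {set E}}) :
  shifted_interval Phi -> shifted_on [set: E] Phi.
Proof.
have closed D : shifted_complex D -> shift_closed [set: E] D.
  move=> [cD sD]; split=> [v F _|u v F _ _ uv vF uF].
    exact: (cD _ F (subD1set F v)).
  exact: (sD _ F (le_C_exchange uv vF uF)).
move=> [_ [D [D' [/closed cD /closed cD' _ PE]]]].
by split=> [F v|]; [rewrite in_setT | exists D, D'].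
Qed.

Theorem theorem5p12 (R : realType) (E : {fset int}) (Phi : {set {set E}}) :
  shifted_interval Phi -> spectral_recursion R Phi.
Proof.
move=> /shifted_on_setT shP e.
rewrite /spectral_recursion_at; cbv zeta.
rewrite (recursion_shifted_on R shP (in_setT e)) -spectrum_poly_contraction mulrA.
reflexivity.
Qed.
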